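(* Let $n\ge2$ and $\alpha\in\left(\frac1n,\,1+\frac1n\right)$. Let $\Sigma\subset\mathbb{R}^{n+1}$ be a strictly convex smooth closed hypersurface and let $F:M^n\to\mathbb{R}^{n+1}$ be a smooth immersion with $F(M^n)=\Sigma$ satisfying $$K^{\alpha}(p)=-\langle F(p),\vec n(p)\rangle\qquad\text{for all }p\in M^n .$$ Assume that the continuous function $w:M^n\to\mathbb{R}$ defined by $$w(p)=K^{\alpha}(p)\,\lambda_{\min}^{-1}(p)-\frac{n\alpha-1}{2n\alpha}\,|F|^2(p)$$ attains its maximum at a point $p_0\in M^n$. Then $F(p_0)$ is an umbilical point of $\Sigma$ and $\nabla|F|^2(p_0)=0$.
   Context: $M^n$ is a closed $n$-dimensional manifold. $K(p)$ is the Gauss curvature (product of the principal curvatures) and $\vec n(p)$ the interior (inward-pointing) unit normal vector of $\Sigma$ at $F(p)$. The second fundamental form is $h_{ij}=\langle\nabla_i\nabla_jF,\vec n\rangle$; strictly convex means $\{h_{ij}\}$ is positive definite everywhere, i.e. all principal curvatures are positive. $\lambda_{\min}(p)$ is the smallest principal curvature of $\Sigma$ at $F(p)$. $|F|^2=\langle F,F\rangle$ with the Euclidean inner product, and $\nabla$ is the gradient/covariant derivative on $M^n$ with respect to the induced metric. A point is umbilical if all principal curvatures there are equal. *)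

(* Defs.v *)
From HB Require Import structures.
From mathcomp Require Import all_boot all_order all_algebra.
From mathcomp Require Import all_classical all_reals all_analysis.
From mathcomp Require Import complex lra.

Set Implicit Arguments.
Unset Strict Implicit.
Unset Printing Implicit Defensive.

Import Order.TTheory GRing.Theory Num.Theory.
Import numFieldNormedType.Exports.

Local Open Scope classical_set_scope.
Local Open Scope ring_scope.

(* The norm `|x| that MathComp-Analysis puts on row vectors is the sup norm;
   Euclidean lengths are expressed through dot. *)
Definition dot (R : realType) (m : nat) (x y : 'rV[R]_m) : R :=
  \sum_(k < m) x 0 k * y 0 k.

Section Calculus.
Context {R : realType} {n : nat} {V : normedModType R}.
Implicit Types (f : 'rV[R]_n -> V) (U : set 'rV[R]_n).

Definition partial (i : 'I_n) f : 'rV[R]_n -> V :=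
  fun u => 'D_(delta_mx 0 i) f u.

(* C^oo: partial derivatives of all orders exist and are differentiable. *)
Definition smooth_on U f : Prop :=
  forall (s : seq 'I_n) u, U u -> differentiable (foldr partial f s) u.

End Calculus.

Section Manifold.
Context {R : realType} {n : nat}.

(* A homeomorphism from an open subset of M to an open subset of R^n; the
   values of the two total functions outside these sets are irrelevant. *)
Record chart (M : topologicalType) := Chart {
  chart_dom : set M;
  chart_cod : set 'rV[R]_n;
  chart_map : M -> 'rV[R]_n;
  chart_inv : 'rV[R]_n -> M;
  chart_dom_open : open chart_dom;
  chart_cod_open : open chart_cod;
  chart_map_cod : forall p, chart_dom p -> chart_cod (chart_map p);
  chart_inv_dom : forall u, chart_cod u -> chart_dom (chart_inv u);
  chart_mapK : forall p, chart_dom p -> chart_inv (chart_map p) = p;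
  chart_invK : forall u, chart_cod u -> chart_map (chart_inv u) = u;
  chart_map_continuous : {within chart_dom, continuous chart_map};
  chart_inv_continuous : {within chart_cod, continuous chart_inv} }.

(* A smooth structure on M: an atlas, indexed so that chart_at p is a chart
   around p (every smooth atlas contains one of this form, which defines the
   same smooth structure). *)
Record smooth_structure (M : topologicalType) := SmoothStructure {
  chart_at : M -> chart M;
  chart_at_dom : forall p, chart_dom (chart_at p) p;
  chart_at_compat : forall p q,
    smooth_on
      (chart_cod (chart_at p) `&`
         [set u | chart_dom (chart_at q) (chart_inv (chart_at p) u)])
      (chart_map (chart_at q) \o chart_inv (chart_at p)) }.

Definition closed_manifold (M : topologicalType) : Prop :=
  [/\ compact [set: M], hausdorff_space M & @second_countable M].

End Manifold.

Arguments chart R n M : clear implicits.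
Arguments smooth_structure R n M : clear implicits.

(* Geometry of a hypersurface parametrized locally by X : R^n -> R^(n+1). *)
Section LocalGeometry.
Context {R : realType} {n : nat}.
Implicit Types (X : 'rV[R]_n -> 'rV[R]_n.+1) (u : 'rV[R]_n) (v : 'rV[R]_n.+1).

Definition metric X u : 'M[R]_n :=
  \matrix_(i, j) dot (partial i X u) (partial j X u).

Definition christoffel X u (k i j : 'I_n) : R :=
  2^-1 * \sum_(l < n) invmx (metric X u) k l *
    (partial i (fun y => metric X y j l : R^o) u
     + partial j (fun y => metric X y i l : R^o) u
     - partial l (fun y => metric X y i j : R^o) u).

(* nabla_i nabla_j X, for the Levi-Civita connection of the metric, applied to
   the components of X *)
Definition cov_hessian X u (i j : 'I_n) : 'rV[R]_n.+1 :=
  partial i (partial j X) u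
  - \sum_(k < n) christoffel X u k i j *: partial k X u.

Definition second_form X v u : 'M[R]_n :=
  \matrix_(i, j) dot (cov_hessian X u i j) v.

(* Row vectors being acted on from the right, w *m shape = k *: w is
   w *m h = k *: (w *m g). *)
Definition shape_operator X v u : 'M[R]_n :=
  second_form X v u *m invmx (metric X u).

End LocalGeometry.

(* The eigenvalues of A with algebraic multiplicity, in nondecreasing order;
   meaningful when char_poly A splits over R. *)
Definition sorted_spectrum (R : realType) (n : nat) (A : 'M[R]_n) : seq R :=
  xget [::] [set s : seq R | sorted <=%R s /\
                             char_poly A = \prod_(k <- s) ('X - k%:P)].

(* It does for the shape operators: h symmetric, g symmetric positive definite. *)
Lemma sorted_spectrumP (R : realType) n (g h : 'M[R]_n) :
  g^T = g -> h^T = h ->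
  (forall w : 'rV_n, w != 0 -> 0 < (w *m g *m w^T) 0 0) ->
  let s := sorted_spectrum (h *m invmx g) in
  sorted <=%R s /\ char_poly (h *m invmx g) = \prod_(k <- s) ('X - k%:P).
Proof.
move=> gT hT gpos.
have gge (w : 'rV_n) : 0 <= (w *m g *m w^T) 0 0.
  have [->|w0] := eqVneq w 0; first by rewrite !mul0mx mxE.
  by apply: ltW; apply: gpos.
have gu : g \in unitmx.
  rewrite -row_free_unit; apply: inj_row_free => v vg.
  apply/eqP; apply: contraT => /gpos; by rewrite vg mul0mx mxE ltxx.
set S := h *m invmx g.
have tr1 (X : 'M[R]_1) : X 0 0 = X^T 0 0 by rewrite mxE.
have real z : root (char_poly (map_mx (real_complex R) S)) z -> complex.Im z = 0.
  rewrite -eigenvalue_root_char => /eigenvalueP[v vS v0].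
  have {}vS : v *m map_mx (real_complex R) h = z *: (v *m map_mx (real_complex R) g).
    by rewrite scalemxAl -vS -mulmxA -map_mxM /S mulmxKV.
  pose a : 'rV[R]_n := map_mx (@complex.Re R) v; pose b : 'rV[R]_n := map_mx (@complex.Im R) v.
  have ReM (u : 'rV[R[i]]_n) (m : 'M[R]_n) : map_mx (@complex.Re R) (u *m map_mx (real_complex R) m) = map_mx (@complex.Re R) u *m m.
    apply/rowP => j; rewrite !mxE raddf_sum /=; apply: eq_bigr => k _.
    by rewrite !mxE; case: (u 0 k) => x y /=; rewrite mulr0 subr0.
  have ImM (u : 'rV[R[i]]_n) (m : 'M[R]_n) : map_mx (@complex.Im R) (u *m map_mx (real_complex R) m) = map_mx (@complex.Im R) u *m m.
    apply/rowP => j; rewrite !mxE raddf_sum /=; apply: eq_bigr => k _.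
    by rewrite !mxE; case: (u 0 k) => x y /=; rewrite mulr0 add0r.
  have Ea : a *m h = complex.Re z *: (a *m g) - complex.Im z *: (b *m g).
    rewrite -ReM vS -ReM -ImM; apply/rowP => j; rewrite !mxE.
    by case: z {vS} => x y; case: (X in _ * X) => p q.
  have Eb : b *m h = complex.Im z *: (a *m g) + complex.Re z *: (b *m g).
    rewrite -ImM vS -ReM -ImM; apply/rowP => j; rewrite !mxE.
    by case: z {vS Ea} => x y; case: (X in _ * X) => p q /=; rewrite addrC.
  have hs : (a *m h *m b^T) 0 0 = (b *m h *m a^T) 0 0.
    by rewrite tr1 !trmx_mul trmxK hT mulmxA.
  have gs : (a *m g *m b^T) 0 0 = (b *m g *m a^T) 0 0.
    by rewrite tr1 !trmx_mul trmxK gT mulmxA.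
  have l1 (P Q : 'M[R]_1) x y : (x *: P - y *: Q) 0 0 = x * P 0 0 - y * Q 0 0 by rewrite !mxE.
  have l2 (P Q : 'M[R]_1) x y : (x *: P + y *: Q) 0 0 = x * P 0 0 + y * Q 0 0 by rewrite !mxE.
  move: hs; rewrite Ea Eb mulmxBl mulmxDl -!scalemxAl l1 l2 gs.
  have ga := gge a; have gb := gge b.
  have E0 : forall p q r s t : R, p * q - t * r = t * s + p * q -> t * (r + s) = 0 by move=> *; lra.
  move=> /E0 /eqP; rewrite mulf_eq0 => /orP[/eqP//|/eqP E].
  case/negP: v0; apply/eqP.
  have a0 : a = 0.
    apply/eqP; apply: contraT => /gpos; lra.
  have b0 : b = 0.
    apply/eqP; apply: contraT => /gpos; lra.
  apply/rowP => j; move/rowP/(_ j): a0; move/rowP/(_ j): b0; rewrite !mxE.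
  by case: (v 0 j) => x y /= -> ->.
have [r Er] := closed_field_poly_normal (char_poly (map_mx (real_complex R) S)).
move: Er; rewrite (monicP (char_poly_monic _)) scale1r => Er.
have rr z : z \in r -> z = (complex.Re z)%:C%C.
  move=> zr; have := real z; rewrite Er root_prod_XsubC zr => /(_ isT).
  by case: z {zr} => x y /= ->.
pose s0 := sort <=%R [seq complex.Re z | z <- r].
have H : sorted <=%R s0 /\ char_poly S = \prod_(k <- s0) ('X - k%:P).
  split; first exact: sort_le_sorted.
  rewrite (perm_big [seq complex.Re z | z <- r]) ?perm_sort //= big_map.
  apply: (map_poly_inj (real_complex R)).
  rewrite map_char_poly Er rmorph_prod /= big_seq [RHS]big_seq.
  by apply: eq_bigr => z /rr {1}->; rewrite rmorphB /= map_polyX map_polyC.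
by move=> s; rewrite /s /sorted_spectrum; case: xgetP => [t _ //|/(_ s0)].
Qed.

Section Hypersurface.
Context {R : realType} {n : nat} {M : topologicalType}.
Context (A : smooth_structure R n M) (F : M -> 'rV[R]_n.+1).
(* nu is meant to be the interior unit normal, see is_interior_unit_normal *)
Context (nu : M -> 'rV[R]_n.+1).
Implicit Types (p : M) (Sigma : set 'rV[R]_n.+1).

Definition coord p : 'rV[R]_n := chart_map (chart_at A p) p.
Definition in_chart (T : Type) (f : M -> T) p : 'rV[R]_n -> T :=
  f \o chart_inv (chart_at A p).

Definition smooth_immersion : Prop :=
  forall p, smooth_on (chart_cod (chart_at A p)) (in_chart F p) /\
    forall u, chart_cod (chart_at A p) u -> injective ('d (in_chart F p) u).

(* Sigma is an embedded smooth hypersurface, compact (hence without boundary) *)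
Definition closed_hypersurface Sigma : Prop :=
  compact Sigma /\
  forall x, Sigma x -> exists (V : set 'rV[R]_n.+1) (f : 'rV[R]_n.+1 -> R^o),
    [/\ open V, V x, smooth_on V f,
        forall y, V y -> exists z, 'd f y z != 0 &
        Sigma `&` V = [set y | f y = 0] `&` V].

(* the points enclosed by Sigma *)
Definition enclosed Sigma : set 'rV[R]_n.+1 :=
  [set x | ~ Sigma x /\ bounded_set (connected_component (~` Sigma) x)].

Definition is_interior_unit_normal Sigma : Prop :=
  forall p, [/\ dot (nu p) (nu p) = 1,
    forall i, dot (partial i (in_chart F p) (coord p)) (nu p) = 0 &
    \forall t \near 0^'+, enclosed Sigma (F p + t *: nu p)].

(* g_ij, h_ij = < nabla_i nabla_j F, nu > at p, in the chart around p *)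
Definition metric_at p : 'M[R]_n := metric (in_chart F p) (coord p).
Definition second_form_at p : 'M[R]_n :=
  second_form (in_chart F p) (nu p) (coord p).

Definition strictly_convex : Prop :=
  forall p (w : 'rV[R]_n), w != 0 -> 0 < (w *m second_form_at p *m w^T) 0 0.

Definition principal_curvatures p : seq R :=
  sorted_spectrum (shape_operator (in_chart F p) (nu p) (coord p)).

Definition gauss_curvature p : R := \prod_(k <- principal_curvatures p) k.

(* principal_curvatures is sorted *)
Definition lambda_min p : R := head 0 (principal_curvatures p).

Definition umbilical p : Prop :=
  {in principal_curvatures p &, forall k l, k = l}.

(* the components g^ij d_j f of the gradient, in the chart around p *)
Definition gradient (f : M -> R) p : 'rV[R]_n :=
  \row_i \sum_(j < n) invmx (metric_at p) i j *
    partial j (in_chart f p : 'rV[R]_n -> R^o) (coord p).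

Definition norm2 p : R := dot (F p) (F p).

Definition w_fun (alpha : R) p : R :=
  gauss_curvature p `^ alpha * (lambda_min p)^-1
  - (n%:R * alpha - 1) / (2 * n%:R * alpha) * norm2 p.

End Hypersurface.

(* Main.v *)
Require Import Defs.
From mathcomp Require Import all_boot all_order all_algebra.
From mathcomp Require Import all_classical all_reals all_analysis.
From mathcomp Require Import perm ring lra.

(* In the frame E_1, ..., E_n, N of principal directions and normal at p0 the
   hypersurface is locally a graph over its tangent plane.  Its slopes y are new
   coordinates, and the vector fields D_i = d/dy_i, written in the original
   chart, commute; so no inverse function theorem is needed.  The Legendre
   transform s of the graph satisfies D_i s = <F, E_i>, and with W = D^2 s and
   rho^2 = 1 + |y|^2 the curvature is K = 1 / (rho^(n+2) det W), the soliton
   equation says s = rho K^alpha, a Monge-Ampere equation, and the radii of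
   curvature are the eigenvalues of rho W with respect to (1 + y^T y)^-1.

   Let b_1 >= b_i be the eigenvalues of W at p0, and
   theta = (n alpha - 1) / (n alpha).  For every vector field zeta, maximality
   of w says that
     Phi = s <W zeta, zeta> - (w(p0) + theta/2 |F|^2) (|zeta|^2 - <zeta, y>^2 (1 - |y|^2))
   is nonpositive near p0 and vanishes at p0 if zeta(p0) = e_1.  Take
   zeta = e_1 + y_1 a with a_k = - theta <F, E_k> / s for k <> 1; this choice of
   the first derivative of zeta replaces the usual analysis of the multiplicity
   of lambda_min.  Then sum_j (alpha / b_j) D_j D_j Phi <= 0, together with
   D_j Phi = 0 and the differentiated Monge-Ampere equation, bounds
     alpha theta s sum_j (b_1 - b_j) + theta sum_j <F, E_j>^2
   above by 0. *)

Set Implicit Arguments.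
Unset Strict Implicit.
Unset Printing Implicit Defensive.

Import Order.TTheory GRing.Theory Num.Theory.
Import numFieldNormedType.Exports.

Local Open Scope classical_set_scope.
Local Open Scope ring_scope.

(** * Directional and partial derivatives *)

(** [lambda_min] need not be differentiable where it is a multiple eigenvalue. It is replaced by the
    inequalities lambda_min <h^-1 w, w> <= <g^-1 w, w>, one for each covector w. With the maximality
    of [w_fun] they bound s <W zeta, zeta> by C (|zeta|^2 - <zeta, y>^2 / rho^2), where C = w(p0) +
    theta/2 |F|^2, and 1 / rho^2 >= 1 - |y|^2 then gives Phi <= 0. Put t_k = D_k W_11. For k <> 1
    the derivative a_k of zeta contributes s (4 a_k t_k - 2 (b_1 - b_k) a_k^2) to D_1 D_1 Phi. The
    optimal a_k = t_k / (b_1 - b_k) is singular when b_k = b_1. Among the values a_k = - c <F, E_k>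
    / s, which are always defined, c = theta is the only choice for which b_k drops out of the final
    terms of index k. For k = 1, where a_1 = 0, the sign comes from n alpha (1 - theta) = 1 and n >=
    2. *)

Lemma diff_remainder (R : realType) (V : normedModType R) (f : V -> R^o) (u : V) : differentiable f u -> forall e : R, 0 < e ->
  exists2 d : R, 0 < d & forall h, `|h| < d ->
    `|f (u + h) - f u - 'd f u h| <= e * `|h|.
Proof.
move=> /diff_locally /eqaddoP E e e0.
have /nbhs_norm0P [d /= d0 Hd] := E _ e0.
exists d => // h /Hd; congr (`|_| <= _).
transitivity (f (u + h) - (f u + 'd f u h)); first by rewrite [u + h]addrC.
by rewrite opprD addrA.
Qed.

Section DirectionalDerivatives.
Context {R : realType} {V : normedModType R}.
Implicit Types (f : V -> R^o) (u v w : V).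

Lemma is_derive_line f u v (t : R) : differentiable f (u + t *: v) ->
  is_derive t (1 : R) (fun s : R => f (u + s *: v) : R^o) ('D_v f (u + t *: v)).
Proof.
move=> /(@diff_derivable _ _ _ _ _ v) df; set g := fun s : R => _.
have E : (fun h : R => h^-1 *: ((g \o shift t) (h *: (1 : R)) - g t)) =
    (fun h : R => h^-1 *: ((f \o shift (u + t *: v)) (h *: v) - f (u + t *: v))).
  apply/funext => h; congr (_ *: (_ - _)); rewrite /g /=.
  by rewrite [h *: 1]mulr1 scalerDl addrCA.
by apply: DeriveDef; rewrite /derivable /derive E.
Qed.

(** The mean value theorem in the direction [v], applied to the difference of [f] along two parallel
    segments, turns the second difference into an increment of ['D_v f], which is then expanded at
    [u]. Differentiability of ['D_v f] at the single point [u] suffices. *)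
Lemma second_difference f u v w :
  (\forall z \near u, differentiable f z) -> differentiable ('D_v f) u ->
  forall e : R, 0 < e -> exists2 d : R, 0 < d & forall t, 0 < t -> t < d ->
    `|f (u + t *: v + t *: w) - f (u + t *: v) - f (u + t *: w) + f u
      - t ^+ 2 * 'D_w ('D_v f) u| <= e * t ^+ 2.
Proof.
move=> /nbhs_normP[/= d1 d10 Hd1] dDf e e0.
(* All points involved lie within t m of [u], so each of the two expansions of ['D_v f] has error at
   most e t / 2. *)
pose m : R := `|v| + `|w| + 1.
have m0 : 0 < m by rewrite /m; have := normr_ge0 v; have := normr_ge0 w; lra.
have e2 : 0 < e / (2 * m) by rewrite divr_gt0 ?mulr_gt0.
have [d2 d20 Hd2] := diff_remainder dDf e2.
exists (Num.min d1 d2 / m); first by rewrite divr_gt0 // lt_min d10.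
move=> t t0; rewrite ltr_pdivlMr // lt_min => /andP[td1 td2].
have bnd (c s : R) : 0 <= c <= t -> 0 <= s <= t -> `|c *: v + s *: w| <= t * m.
  move=> /andP[c0 ct] /andP[s0 st].
  apply: le_trans (ler_normD _ _) _; rewrite !normrZ !ger0_norm // /m.
  have := ler_wpM2r (normr_ge0 v) ct; have := ler_wpM2r (normr_ge0 w) st; lra.
have t01 : 0 <= t <= t by rewrite lexx ltW.
have z01 : 0 <= (0 : R) <= t by rewrite lexx ltW.
have dfl c s : 0 <= c <= t -> 0 <= s <= t ->
    differentiable f (u + s *: w + c *: v).
  move=> hc hs; apply: Hd1; rewrite /= -addrA opprD addrA subrr add0r normrN addrC.
  exact: le_lt_trans (bnd _ _ hc hs) td1.
pose phi (s : R) : R^o := f (u + t *: w + s *: v) - f (u + 0 *: w + s *: v).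
have dphi (s : R^o) : 0 <= s <= t -> is_derive s (1 : R) phi
    ('D_v f (u + t *: w + s *: v) - 'D_v f (u + 0 *: w + s *: v)).
  by move=> hs; apply: is_deriveB; apply: is_derive_line; apply: dfl.
have [||c ct E] := @MVT_segment R phi (fun s => 'D_v f (u + t *: w + s *: v) - 'D_v f (u + 0 *: w + s *: v)) 0 t (ltW t0).
- move=> s /itvP st; apply: dphi; rewrite !ltW ?st //.
- apply: derivable_within_continuous => s; rewrite in_itv /= => st.
  by apply: ex_derive; apply: dphi st.
have {}ct : 0 <= c <= t by move: ct; rewrite in_itv.
set D := 'D_w _ _.
have -> : f (u + t *: v + t *: w) - f (u + t *: v) - f (u + t *: w) + f u = phi t - phi 0.
  by rewrite /phi !scale0r !addr0 (addrAC u (t *: w)); lra.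
have r1 := Hd2 (c *: v + t *: w) (le_lt_trans (bnd _ _ ct t01) td2).
have r2 := Hd2 (c *: v + 0 *: w) (le_lt_trans (bnd _ _ ct z01) td2).
have lim1 := ler_wpM2l (ltW e2) (bnd _ _ ct t01).
have lim2 := ler_wpM2l (ltW e2) (bnd _ _ ct z01).
have em : e / (2 * m) * (t * m) = e / 2 * t by field; rewrite gt_eqF.
have Ew : 'd ('D_v f) u (c *: v + t *: w) = 'd ('D_v f) u (c *: v) + t * D.
  by rewrite linearD /D (deriveE w dDf); congr (_ + _); rewrite [LHS]linearZ.
have Ev : 'd ('D_v f) u (c *: v + 0 *: w) = 'd ('D_v f) u (c *: v).
  by rewrite scale0r addr0.
rewrite E subr0.
have Ea : u + t *: w + c *: v = u + (c *: v + t *: w) by rewrite addrAC addrA.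
have Eb : u + 0 *: w + c *: v = u + (c *: v + 0 *: w) by rewrite addrAC addrA.
rewrite Ea Eb.
have -> : t ^+ 2 * D = t * D * t by ring.
rewrite -mulrBl normrM (gtr0_norm t0) expr2 mulrA ler_pM2r //.
have := le_trans r1 lim1; have := le_trans r2 lim2.
rewrite Ew Ev em; move: ('d _ u (c *: v)) ('D_v f _) ('D_v f _) ('D_v f u) (t * D).
move=> a1 a2 a3 a4 a5; have -> : e * t = 2 * (e / 2 * t) by field.
move: (e / 2 * t) => b.
clear; rewrite !ler_norml => /andP[? ?] /andP[? ?]; apply/andP; split; lra.
Qed.

Lemma approx_uniq (x y z w a b e : R) : `|x - y - z + w - a| <= e ->
  `|x - z - y + w - b| <= e -> `|a - b| <= 2 * e.
Proof.
by rewrite !ler_norml => /andP[? ?] /andP[? ?]; apply/andP; split; lra.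
Qed.

(** The second difference is symmetric in [v] and [w], and both iterated derivatives are its limit
    after division by t^2. *)
Lemma deriveC f u v w :
  (\forall z \near u, differentiable f z) ->
  differentiable ('D_v f) u -> differentiable ('D_w f) u ->
  'D_w ('D_v f) u = 'D_v ('D_w f) u.
Proof.
move=> df dv dw; apply/eqP; rewrite -subr_eq0 -normr_le0.
apply/ler_addgt0Pr => /= e e0; rewrite add0r.
have e2 : 0 < e / 2 by rewrite divr_gt0.
have [d1 d10 H1] := second_difference w df dv e2.
have [d2 d20 H2] := second_difference v df dw e2.
pose t := Num.min d1 d2 / 2.
have m0 : 0 < Num.min d1 d2 by rewrite lt_min d10.
have t0 : 0 < t by rewrite divr_gt0.
have tm : t < Num.min d1 d2 by rewrite /t; lra.
have := tm; rewrite lt_min => /andP[/(H1 _ t0) + /(H2 _ t0)].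
move=> h1; rewrite (addrAC u (t *: w)) => h2.
have t20 : 0 < t ^+ 2 by rewrite exprn_gt0.
rewrite -(ler_pM2r t20) -{1}(gtr0_norm t20) -normrM.
rewrite (mulrC _ (t ^+ 2)) mulrBr.
have -> : e * t ^+ 2 = 2 * (e / 2 * t ^+ 2) by field.
exact: approx_uniq h1 h2.
Qed.

(** If c were positive, [dphi] would be positive just to the right of 0, and by the mean value
    theorem [phi] would exceed its maximum there. *)
Lemma second_derivative_test (phi dphi : R -> R^o) (c d : R) :
  0 < d -> (forall t : R, `|t| < d -> is_derive t (1 : R) phi (dphi t)) ->
  is_derive (0 : R) (1 : R) dphi c ->
  (forall t : R, `|t| < d -> phi t <= phi 0) -> dphi 0 = 0 /\ c <= 0.
Proof.
move=> d0 dp ddp pmax.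
have nd (t : R) : (t \in `]-d, d[%R) = (`|t| < d) by rewrite in_itv /= ltr_norml.
have E0 : dphi 0 = 0.
  have H : is_derive (0 : R) (1 : R) phi 0.
    apply: (@derive1_at_max _ _ (-d) d); rewrite ?nd ?normr0 //; first lra.
      by move=> t; rewrite nd => /dp [].
    by move=> t; rewrite nd; apply: pmax.
  by have [_ <-] := dp 0 ltac:(by rewrite normr0); have [_ ->] := H.
split=> //; rewrite leNgt; apply/negP => c0.
have [ddp1 ddp2] := ddp.
have dd : differentiable dphi (0 : R) by apply/derivable1_diffP.
have c2 : 0 < c / 2 by rewrite divr_gt0.
have [e e0 He] := diff_remainder dd c2.
pose s := Num.min d e / 2.
have m0 : 0 < Num.min d e by rewrite lt_min d0.
have s0 : 0 < s by rewrite divr_gt0.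
have sm : s < Num.min d e by rewrite /s; lra.
have pos t : 0 < t -> t <= s -> 0 < dphi t.
  move=> t0 ts; have te : `|t| < e.
    rewrite gtr0_norm //; apply: le_lt_trans ts _; apply: lt_le_trans sm _.
    by rewrite ge_min lexx orbT.
  have := He t te.
  have -> : 'd dphi 0 t = t * c by rewrite -{1}[t]mulr1 [LHS]linearZ -(deriveE _ dd) ddp2.
  rewrite add0r E0 subr0 (gtr0_norm t0) ler_norml => /andP[+ _].
  have := mulr_gt0 t0 c0; lra.
have [||x] := @MVT R phi dphi 0 s s0.
- move=> t /itvP ts; apply: dp; rewrite gtr0_norm ?ts //.
  apply: lt_trans (_ : t < s) _; first by rewrite ts.
  by apply: lt_le_trans sm _; rewrite ge_min lexx.
- apply: derivable_within_continuous => t /itvP ts.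
  apply: ex_derive; apply: dp; rewrite ger0_norm ?ts //.
  apply: le_lt_trans (_ : t <= s) _; first by rewrite ts.
  by apply: lt_le_trans sm _; rewrite ge_min lexx.
move=> /itvP xs; rewrite subr0 => E.
have : 0 < phi s - phi 0 by rewrite E mulr_gt0 // pos ?xs // ltW ?xs.
rewrite subr_gt0 ltNge pmax // gtr0_norm //.
by apply: lt_le_trans sm _; rewrite ge_min lexx.
Qed.

Lemma second_derive_at_max f u v :
  (\forall z \near u, differentiable f z) -> differentiable ('D_v f) u ->
  (\forall z \near u, f z <= f u) -> 'D_v f u = 0 /\ 'D_v ('D_v f) u <= 0.
Proof.
move=> df dDf fmax.
have [d1 /= d10 Hd1] := (nbhs_normP _ _).1 (filterI df fmax).
have m0 : 0 < `|v| + 1 by have := normr_ge0 v; lra.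
have := @second_derivative_test (fun t => f (u + t *: v)) (fun t => 'D_v f (u + t *: v))
  ('D_v ('D_v f) u) (d1 / (`|v| + 1)).
rewrite scale0r addr0; apply.
- by rewrite divr_gt0.
- move=> t td; apply: is_derive_line.
  apply: (Hd1 _ _).1; rewrite /= opprD addrA subrr add0r normrN normrZ.
  apply: le_lt_trans (_ : `|t| * (`|v| + 1) < _); last by rewrite -ltr_pdivlMr.
  by rewrite ler_wpM2l // lerDl.
- have H := @is_derive_line ('D_v f) u v 0; rewrite scale0r addr0 in H.
  exact: H.
- move=> t td; apply: (Hd1 _ _).2; rewrite /= opprD addrA subrr add0r normrN normrZ.
  apply: le_lt_trans (_ : `|t| * (`|v| + 1) < _); last by rewrite -ltr_pdivlMr.
  by rewrite ler_wpM2l // lerDl.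
Qed.

End DirectionalDerivatives.

(** * Partial derivatives and smooth functions on an open set of coordinates *)

Section Partial.
Context {R : realType} {n : nat}.
Implicit Types (f g : 'rV[R]_n -> R^o) (u v : 'rV[R]_n) (U : set 'rV[R]_n).

Lemma near_open (T : topologicalType) (U : set T) (P : T -> Prop) (x : T) :
  open U -> U x -> (forall y : T, U y -> P y) -> \forall y \near x, P y.
Proof. by move=> oU Uu UP; apply: filterS UP _; exact: open_nbhs_nbhs. Qed.

Lemma partial_ext (V : normedModType R) U (f g : 'rV[R]_n -> V) i u :
  open U -> U u -> (forall v, U v -> f v = g v) -> partial i f u = partial i g u.
Proof. by move=> oU Uu fg; apply: near_eq_derive; exact: near_open fg. Qed.

Lemma differentiable_ext (V : normedModType R) U (f g : 'rV[R]_n -> V) u :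
  open U -> U u -> (forall v, U v -> f v = g v) -> differentiable f u -> differentiable g u.
Proof.
move=> oU Uu fg df.
have E : g \o shift u = cst (g u) + 'd f u +o_ (0 : 'rV[R]_n) id.
  apply/eqaddoP => e e0; have /eqaddoP /(_ e e0) H := diff_locally df.
  have : \forall h \near (0 : 'rV[R]_n), f (h + u) = g (h + u).
    have := near_open oU Uu fg; rewrite -{1}(add0r u).
    by rewrite (near_shift (0 : 'rV[R]_n)) subr0 add0r.
  apply: filterS2 H => h + fgh; congr (`|_| <= _).
  rewrite /= -[LHS]/(f (h + u) - (f u + 'd f u h)) -[RHS]/(g (h + u) - (g u + 'd f u h)).
  by rewrite fgh fg.
apply/diff_locallyP; rewrite (diff_unique _ E); last exact: diff_continuous.
by split=> //; apply: diff_continuous.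
Qed.

Lemma derive_partial (V : normedModType R) (f : 'rV[R]_n -> V) u v : differentiable f u ->
  'D_v f u = \sum_k v 0 k *: partial k f u.
Proof.
move=> df; rewrite deriveE // {1}(row_sum_delta v) linear_sum /=.
by apply: eq_bigr => k _; rewrite linearZ /partial deriveE.
Qed.

Lemma partialD f g i u : differentiable f u -> differentiable g u ->
  partial i (fun v => f v + g v : R^o) u = partial i f u + partial i g u.
Proof. by move=> df dg; rewrite /partial -deriveD //; apply: diff_derivable. Qed.

Lemma partialM f g i u : differentiable f u -> differentiable g u ->
  partial i (fun v => f v * g v : R^o) u = partial i f u * g u + f u * partial i g u.
Proof.
move=> df dg; rewrite /partial; have := @deriveM _ _ f g u (delta_mx 0 i).
rewrite addrC (mulrC (partial i f u)); apply; exact: diff_derivable.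
Qed.

Lemma partial_cst (c : R) i (u : 'rV[R]_n) : partial i (fun=> c : R^o) u = 0.
Proof. exact: derive_cst. Qed.

Lemma partialV f i u : differentiable f u -> f u != 0 ->
  partial i (fun v => (f v)^-1 : R^o) u = - (partial i f u * ((f u)^-1 * (f u)^-1)).
Proof.
move=> df f0; rewrite /partial; have := @deriveV _ _ f u (delta_mx 0 i) f0.
move=> ->; last exact: diff_derivable.
by rewrite scaleNr -invfM -expr2; congr (- _); exact: mulrC.
Qed.

Lemma differentiable_ln f u : differentiable f u -> 0 < f u ->
  differentiable (fun v => ln (f v) : R^o) u.
Proof.
move=> df f0; have [d1 _] := is_derive1_ln f0.
by apply: (@differentiable_comp _ _ _ _ f (@ln R : R^o -> R^o)) => //; apply/derivable1_diffP.
Qed.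

Lemma partial_ln f i u : differentiable f u -> 0 < f u ->
  partial i (fun v => ln (f v) : R^o) u = partial i f u / f u.
Proof.
move=> df f0.
have [d1 d2] := is_derive1_ln f0.
have dl : differentiable (@ln R : R^o -> R^o) (f u) by apply/derivable1_diffP.
rewrite /partial deriveE; last exact: differentiable_ln.
rewrite (diff_comp df dl) /=.
have lE (c : R) : 'd (@ln R : R^o -> R^o) (f u) c = c * (f u)^-1.
  by rewrite -{1}[c]mulr1 [LHS]linearZ -(deriveE _ dl) d2.
by rewrite lE deriveE.
Qed.

Lemma partial_sum (I : Type) (r : seq I) (F : I -> 'rV[R]_n -> R^o) i u :
  (forall k, differentiable (F k) u) ->
  partial i (fun v => \sum_(k <- r) F k v : R^o) u = \sum_(k <- r) partial i (F k) u.
Proof.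
move=> dF; elim: r => [|k r IH].
  by rewrite big_nil -[RHS](partial_cst 0 i u); congr (partial _ _ _); apply/funext=> v; rewrite big_nil.
have dS : differentiable (fun v => \sum_(k <- r) F k v : R^o) u.
  elim: r {IH} => [|j r IH].
    rewrite (_ : (fun _ => _) = cst 0); first exact: differentiable_cst.
    by apply/funext => v; rewrite big_nil.
  rewrite (_ : (fun _ => _) = F j + (fun v => \sum_(k <- r) F k v : R^o)).
    exact: differentiableD.
  by apply/funext => v; rewrite big_cons.
rewrite big_cons -IH -partialD //; congr (partial _ _ _); apply/funext=> v; by rewrite big_cons.
Qed.

(** A syntactic closure of [smooth_on]: stability under [partial] follows by induction from the
    differentiation rules, without a Leibniz formula for iterated derivatives. Equality is required
    on [U] only, because values outside a chart are irrelevant. *)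
Inductive smooth_fun U : ('rV[R]_n -> R^o) -> Prop :=
| smooth_fun_base f : smooth_on U f -> smooth_fun U f
| smooth_fun_ext f g : smooth_fun U f -> (forall u, U u -> f u = g u) -> smooth_fun U g
| smooth_fun_cst c : smooth_fun U (fun=> c)
| smooth_funD f g : smooth_fun U f -> smooth_fun U g -> smooth_fun U (fun u => f u + g u)
| smooth_funM f g : smooth_fun U f -> smooth_fun U g -> smooth_fun U (fun u => f u * g u)
| smooth_funV f : smooth_fun U f -> (forall u, U u -> f u != 0) ->
    smooth_fun U (fun u => (f u)^-1)
| smooth_fun_ln f : smooth_fun U f -> (forall u, U u -> 0 < f u) ->
    smooth_fun U (fun u => ln (f u)).

Lemma smooth_funW U U' f : U' `<=` U -> smooth_fun U f -> smooth_fun U' f.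
Proof.
move=> UU'; elim=> {f} [f sf|f g _ sf fg|c|f g _ sf _ sg|f g _ sf _ sg|f _ sf f0|f _ sf f0].
- by apply: smooth_fun_base => s u /UU'; apply: sf.
- by apply: smooth_fun_ext sf _ => u /UU'; apply: fg.
- exact: smooth_fun_cst.
- exact: smooth_funD.
- exact: smooth_funM.
- by apply: smooth_funV sf _ => u /UU'; apply: f0.
- by apply: smooth_fun_ln sf _ => u /UU'; apply: f0.
Qed.

Lemma smooth_fun_diff U f u : open U -> smooth_fun U f -> U u -> differentiable f u.
Proof.
move=> oU sf Uu; elim: sf => {f} [f sf|f g _ sf fg|c|f g _ sf _ sg|f g _ sf _ sg|f _ sf f0|f _ sf f0].
- exact: (sf [::] u Uu).
- exact: differentiable_ext oU Uu fg sf.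
- exact: differentiable_cst.
- exact: differentiableD.
- exact: differentiableM.
- by apply: differentiableV => //; apply: f0.
- by apply: differentiable_ln => //; apply: f0.
Qed.

Lemma smooth_fun_partial U f i : open U -> smooth_fun U f -> smooth_fun U (partial i f).
Proof.
move=> oU; elim=> {f} [f sf|f g sf0 sf fg|c|f g sf0 sf sg0 sg|f g sf0 sf sg0 sg|f sf0 sf f0|f sf0 sf f0].
- apply: smooth_fun_base => s u Uu.
  by have := sf (rcons s i) u Uu; rewrite -cats1 foldr_cat.
- by apply: smooth_fun_ext sf _ => u Uu; apply: partial_ext oU Uu fg.
- by apply: smooth_fun_ext (smooth_fun_cst _ 0) _ => u _; rewrite partial_cst.
- apply: smooth_fun_ext (smooth_funD sf sg) _ => u Uu.
  by rewrite partialD //; apply: smooth_fun_diff Uu.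
- apply: smooth_fun_ext (smooth_funD (smooth_funM sf sg0) (smooth_funM sf0 sg)) _ => u Uu.
  by rewrite partialM //; apply: smooth_fun_diff Uu.
- have sv := smooth_funV sf0 f0.
  apply: smooth_fun_ext (smooth_funM (smooth_fun_cst _ (-1)) (smooth_funM sf (smooth_funM sv sv))) _ => u Uu.
  by rewrite partialV ?mulN1r //; [apply: smooth_fun_diff Uu | apply: f0].
- have fn0 u : U u -> f u != 0 by move=> /f0; apply: lt0r_neq0.
  apply: smooth_fun_ext (smooth_funM sf (smooth_funV sf0 fn0)) _ => u Uu.
  by rewrite partial_ln //; [apply: smooth_fun_diff Uu | apply: f0].
Qed.

Lemma smooth_funN U f : smooth_fun U f -> smooth_fun U (fun u => - f u).
Proof.
move=> sf; apply: smooth_fun_ext (smooth_funM (smooth_fun_cst _ (-1)) sf) _ => u _.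
by rewrite mulN1r.
Qed.

Lemma smooth_funB U f g : smooth_fun U f -> smooth_fun U g -> smooth_fun U (fun u => f u - g u).
Proof. by move=> sf sg; apply: smooth_funD sf (smooth_funN sg). Qed.

Lemma smooth_fun_sum U (I : Type) (r : seq I) (F : I -> 'rV[R]_n -> R^o) :
  (forall k, smooth_fun U (F k)) -> smooth_fun U (fun u => \sum_(k <- r) F k u).
Proof.
move=> sF; elim: r => [|k r IH].
  by apply: smooth_fun_ext (smooth_fun_cst _ 0) _ => u _; rewrite big_nil.
by apply: smooth_fun_ext (smooth_funD (sF k) IH) _ => u _; rewrite big_cons.
Qed.

Lemma smooth_fun_prod U (I : Type) (r : seq I) (F : I -> 'rV[R]_n -> R^o) :
  (forall k, smooth_fun U (F k)) -> smooth_fun U (fun u => \prod_(k <- r) F k u).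
Proof.
move=> sF; elim: r => [|k r IH].
  by apply: smooth_fun_ext (smooth_fun_cst _ 1) _ => u _; rewrite big_nil.
by apply: smooth_fun_ext (smooth_funM (sF k) IH) _ => u _; rewrite big_cons.
Qed.

Lemma smooth_fun_det U m (A : 'rV[R]_n -> 'M[R]_m) :
  (forall i j, smooth_fun U (fun u => A u i j)) -> smooth_fun U (fun u => \det (A u)).
Proof.
move=> sA; apply: smooth_fun_sum => s; apply: smooth_funM; first exact: smooth_fun_cst.
by apply: smooth_fun_prod => k.
Qed.

Lemma smooth_fun_invmx U m (A : 'rV[R]_n -> 'M[R]_m) :
  (forall u, U u -> A u \in unitmx) ->
  (forall i j, smooth_fun U (fun u => A u i j)) ->
  forall i j, smooth_fun U (fun u => invmx (A u) i j).
Proof.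
move=> uA sA i j.
have sc : smooth_fun U (fun u => cofactor (A u) j i).
  apply: smooth_funM; first exact: smooth_fun_cst.
  apply: smooth_fun_det => k l; apply: smooth_fun_ext (sA _ _) _ => u _; rewrite !mxE; reflexivity.
have sd : smooth_fun U (fun u => (\det (A u))^-1).
  by apply: smooth_funV (smooth_fun_det sA) _ => u /uA; rewrite unitmxE unitfE.
apply: smooth_fun_ext (smooth_funM sd sc) _ => u /uA; rewrite /invmx => ->.
by rewrite !mxE.
Qed.

Lemma partialC U f i j u : open U -> smooth_fun U f -> U u ->
  partial i (partial j f) u = partial j (partial i f) u.
Proof.
move=> oU sf Uu; apply: deriveC.
- by apply: (near_open oU Uu) => v; exact: smooth_fun_diff oU sf.
- exact: smooth_fun_diff oU (smooth_fun_partial j oU sf) Uu.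
- exact: smooth_fun_diff oU (smooth_fun_partial i oU sf) Uu.
Qed.

End Partial.

(** * Simultaneous diagonalization and principal curvatures *)

Section SimultaneousDiagonalization.
Context {R : realType}.

Definition posdef n (g : 'M[R]_n) : Prop :=
  forall w : 'rV_n, w != 0 -> 0 < (w *m g *m w^T) 0 0.

Lemma posdef_unitmx n (g : 'M[R]_n) : posdef g -> g \in unitmx.
Proof.
move=> gpos; rewrite -row_free_unit; apply: inj_row_free => v vg.
by apply/eqP; apply: contraT => /gpos; rewrite vg mul0mx mxE ltxx.
Qed.

Lemma posdef_congr n m (g : 'M[R]_n) (P : 'M[R]_(m, n)) : row_free P ->
  posdef g -> posdef (P *m g *m P^T).
Proof.
move=> uP gpos w w0; rewrite !mulmxA -mulmxA -trmx_mul; apply: gpos.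
by apply: contra_neq w0 => /(canRL (mulmxKp uP)) ->; rewrite mul0mx.
Qed.

Lemma exists_generalized_eigenvector n (g h : 'M[R]_n.+1) :
  g^T = g -> h^T = h -> posdef g ->
  exists (a : R) (v : 'rV_n.+1), v != 0 /\ v *m h = a *: (v *m g).
Proof.
move=> gT hT gpos; have [_ E] := sorted_spectrumP gT hT gpos.
case: (sorted_spectrum _) E => [|a s] E.
  have := size_char_poly (h *m invmx g); by rewrite E big_nil size_poly1.
exists a; have : eigenvalue (h *m invmx g) a.
  by rewrite eigenvalue_root_char E big_cons rootM root_XsubC eqxx.
move=> /eigenvalueP[v Ev v0]; exists v; split=> //.
by rewrite scalemxAl -Ev -mulmxA mulmxKV // posdef_unitmx.
Qed.

Lemma orthogonal_complement n (x : 'cV[R]_n.+1) : x != 0 ->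
  exists C : 'M[R]_(n, n.+1), row_free C /\ C *m x = 0.
Proof.
move=> x0; have : \rank (kermx x) = n.
  by rewrite mxrank_ker -mxrank_tr rank_rV trmx_eq0 x0 subSS subn0.
have C1 : row_free (row_base (kermx x)) by rewrite row_base_free.
have C2 : row_base (kermx x) *m x = 0.
  by apply/sub_kermxP; rewrite eq_row_base.
(* The basis has [\rank (kermx x)] rows; it is generalized so that this rank can be rewritten to [n]
   in its type. *)
by move: (row_base _) C1 C2 => C C1 C2 E; move: C C1 C2; rewrite E => C; exists C.
Qed.

(** Induction on the dimension: a [g]-unit eigenvector [w] is split off, and [C] spans its
    [g]-orthogonal complement. Since w h = a w g, this complement is also [h]-orthogonal to [w]. For
    the two fundamental forms the rows of [P] are principal directions. *)
Lemma simultaneous_diagonalization n (g h : 'M[R]_n) :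
  g^T = g -> h^T = h -> posdef g ->
  exists (P : 'M[R]_n) (d : 'rV[R]_n), P *m g *m P^T = 1%:M /\ P *m h *m P^T = diag_mx d.
Proof.
elim: n g h => [|n IH] g h gT hT gpos.
  by exists 1%:M, 0; split; apply/matrixP => -[].
have [a [v [v0 Ev]]] := exists_generalized_eigenvector gT hT gpos.
pose c := (v *m g *m v^T) 0 0.
have c0 : 0 < c by exact: gpos.
pose w := (Num.sqrt c)^-1 *: v.
have wg : w *m g *m w^T = 1%:M.
  rewrite /w linearZ /= -!scalemxAl -scalemxAr scalerA.
  rewrite [v *m g *m v^T]mx11_scalar -/c -mul_scalar_mx -scalar_mxM -invfM -expr2.
  by rewrite sqr_sqrtr ?ltW // mulVf // gt_eqF.
have {Ev} wh : w *m h = a *: (w *m g).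
  by rewrite /w -!scalemxAl Ev scalerA mulrC scalerA.
have gw0 : g *m w^T != 0.
  apply/eqP => E; have := congr1 (fun A : 'M[R]_1 => A 0 0) wg.
  by rewrite -mulmxA E mulmx0 !mxE eqxx => /eqP; rewrite eq_sym oner_eq0.
have [C [C1 C2]] := orthogonal_complement gw0.
have tr_congr (A : 'M[R]_n.+1) : A^T = A -> (C *m A *m C^T)^T = C *m A *m C^T.
  by move=> AT; rewrite !trmx_mul trmxK AT mulmxA.
have [P [d [Pg Ph]]] := IH _ _ (tr_congr _ gT) (tr_congr _ hT) (posdef_congr C1 gpos).
have wC : w *m g *m C^T = 0.
  by apply: trmx_inj; rewrite !trmx_mul trmxK gT C2 trmx0.
have Cw : C *m h *m w^T = 0.
  by apply: trmx_inj; rewrite !trmx_mul trmxK hT mulmxA wh -scalemxAl wC scaler0 trmx0.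
pose Q : 'M[R]_(1 + n, n.+1) := col_mx w (P *m C).
have Qg : Q *m g *m Q^T = 1%:M.
  rewrite /Q mul_col_mx tr_col_mx mul_col_row scalar_mx_block; congr block_mx.
  - exact: wg.
  - by rewrite trmx_mul mulmxA wC mul0mx.
  - by rewrite -!mulmxA C2 mulmx0.
  - by rewrite -Pg trmx_mul !mulmxA.
have Qh : Q *m h *m Q^T = diag_mx (row_mx a%:M d).
  rewrite /Q mul_col_mx tr_col_mx mul_col_row diag_mx_row; congr block_mx.
  - rewrite wh -scalemxAl wg scale_scalar_mx mulr1.
    by apply/matrixP => i j; rewrite !ord1 !mxE eqxx.
  - by rewrite wh -scalemxAl trmx_mul mulmxA wC mul0mx scaler0.
  - by rewrite -!mulmxA (mulmxA C) Cw mulmx0.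
  - by rewrite -Ph trmx_mul !mulmxA.
by exists Q, (row_mx a%:M d).
Qed.

End SimultaneousDiagonalization.

Section Spectrum.
Context {R : realType} {n : nat}.
Implicit Types (g h P Q : 'M[R]_n) (d : 'rV[R]_n).

Lemma char_poly_conj P Q h : P *m Q = 1%:M -> char_poly (P *m h *m Q) = char_poly h.
Proof.
move=> PQ; have PQ' : map_mx polyC P *m map_mx polyC Q = 1%:M.
  by rewrite -map_mxM PQ map_mx1.
rewrite /char_poly /char_poly_mx.
have -> : 'X%:M - map_mx polyC (P *m h *m Q) =
    map_mx polyC P *m ('X%:M - map_mx polyC h) *m map_mx polyC Q.
  by rewrite mulmxBr mulmxBl scalar_mxC -(mulmxA 'X%:M) PQ' mulmx1 !map_mxM.
by rewrite !det_mulmx mulrAC -det_mulmx PQ' det1 mul1r.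
Qed.

Section Diagonalized.
Variables (g h P : 'M[R]_n) (d : 'rV[R]_n).
Hypotheses (Pg : P *m g *m P^T = 1%:M) (Ph : P *m h *m P^T = diag_mx d).

Lemma diagonalizing_unitmx : P \in unitmx.
Proof. by have [] := mulmx1_unit (etrans (mulmxA _ _ _) Pg). Qed.

Let uP := diagonalizing_unitmx.

Lemma diagonalized_invmx : invmx g = P^T *m P.
Proof.
have ug : g *m (P^T *m P) = 1%:M.
  by rewrite -[LHS](mulKmx uP) [P *m _](_ : _ = P) ?mulVmx // !mulmxA Pg mul1mx.
have [gu _] := mulmx1_unit ug.
by rewrite -[LHS]mulmx1 -ug mulKmx.
Qed.

Lemma diagonalized_shape : h *m invmx g = invmx P *m diag_mx d *m P.
Proof. by rewrite diagonalized_invmx -Ph !mulmxA mulVmx ?mul1mx. Qed.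

Lemma diagonalized_spectrum : g^T = g -> h^T = h -> posdef g ->
  perm_eq (sorted_spectrum (h *m invmx g)) [seq d 0 i | i <- enum 'I_n].
Proof.
move=> gT hT gpos; have [_] := sorted_spectrumP gT hT gpos.
rewrite {1}diagonalized_shape char_poly_conj ?mulVmx // char_poly_trig ?diag_mx_is_trig //.
move=> E; apply: prod_XsubC_eq; rewrite -E big_map big_enum.
by apply: eq_bigr => i _; rewrite mxE eqxx mulr1n.
Qed.

Lemma diagonalized_posdef i : posdef h -> 0 < d 0 i.
Proof.
move=> hpos; have e0 : delta_mx (0 : 'I_1) i *m P != 0.
  apply/eqP => E; have := congr1 (fun A => A *m invmx P) E.
  rewrite mulmxK // mul0mx => /matrixP/(_ 0 i); rewrite !mxE !eqxx => /eqP.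
  by rewrite oner_eq0.
have := hpos _ e0; rewrite trmx_mul !mulmxA -(mulmxA _ P) -(mulmxA _ _ P^T) Ph.
rewrite -rowE trmx_delta -colE !mxE eqxx mulr1n //.
Qed.

Lemma diagonalized_det : \prod_i d 0 i = \det h / \det g.
Proof.
have Eg := congr1 determinant Pg; have Eh := congr1 determinant Ph.
rewrite !det_mulmx det_tr det1 in Eg; rewrite !det_mulmx det_tr det_diag in Eh.
have P0 : \det P != 0 by rewrite -unitfE -unitmxE uP.
have g0 : \det g != 0.
  by apply/eqP => E; move/eqP: Eg; rewrite E mulr0 mul0r eq_sym oner_eq0.
rewrite -Eh; apply: (canRL (mulfK g0)).
transitivity (\det h * (\det P * \det g * \det P)); first by ring.
by rewrite Eg mulr1.
Qed.

Lemma diagonalized_form (w : 'rV[R]_n) : posdef h ->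
  (w *m invmx h *m w^T) 0 0 = \sum_i (w *m P^T) 0 i ^+ 2 / d 0 i /\
  (w *m invmx g *m w^T) 0 0 = \sum_i (w *m P^T) 0 i ^+ 2.
Proof.
move=> hpos; have uh := posdef_unitmx hpos.
have sq (e : 'rV[R]_n) (x : 'rV[R]_n) : (x *m diag_mx e *m x^T) 0 0 = \sum_i x 0 i ^+ 2 * e 0 i.
  rewrite mxE; apply: eq_bigr => i _; rewrite mul_mx_diag !mxE expr2; ring.
have d0 i := diagonalized_posdef i hpos.
pose e : 'rV[R]_n := \row_i (d 0 i)^-1.
have he : h *m (P^T *m diag_mx e *m P) = 1%:M.
  rewrite -[LHS](mulKmx uP) [P *m _](_ : _ = P) ?mulVmx // !mulmxA Ph mulmx_diag.
  suff -> : (\row_j (d 0 j * e 0 j)) = const_mx 1 by rewrite diag_const_mx mul1mx.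
  by apply/rowP => j; rewrite !mxE mulfV // gt_eqF.
have -> : invmx h = P^T *m diag_mx e *m P by rewrite -[LHS]mulmx1 -he mulKmx.
rewrite diagonalized_invmx; split.
  transitivity ((w *m P^T *m diag_mx e *m (w *m P^T)^T) 0 0).
    by rewrite trmx_mul trmxK !mulmxA.
  by rewrite sq; apply: eq_bigr => i _; rewrite [e 0 i]mxE.
transitivity ((w *m P^T *m diag_mx (const_mx 1) *m (w *m P^T)^T) 0 0).
  by rewrite trmx_mul trmxK diag_const_mx mulmx1 !mulmxA.
by rewrite sq; apply: eq_bigr => i _; rewrite [const_mx 1 0 i]mxE mulr1.
Qed.
End Diagonalized.

(** The last conjunct is the form in which the smallest eigenvalue is used near the maximum: one
    inequality for each fixed [w] instead of a function that may fail to be differentiable. In the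
    diagonalizing basis it says that head 0 s / d_i <= 1. *)
Lemma spectrum_min g h : (0 < n)%N -> g^T = g -> h^T = h -> posdef g -> posdef h ->
  let s := sorted_spectrum (h *m invmx g) in
  [/\ \prod_(k <- s) k = \det h / \det g, 0 < \prod_(k <- s) k, 0 < head 0 s,
    forall k, k \in s -> head 0 s <= k &
    forall w : 'rV_n, head 0 s * (w *m invmx h *m w^T) 0 0 <= (w *m invmx g *m w^T) 0 0].
Proof.
move=> n0 gT hT gpos hpos s.
have [P [d [Pg Ph]]] := simultaneous_diagonalization gT hT gpos.
have perm := diagonalized_spectrum Pg Ph gT hT gpos; rewrite -/s in perm.
have d0 i := diagonalized_posdef Pg Ph i hpos.
have [ss _] := sorted_spectrumP gT hT gpos; rewrite -/s in ss.
have sd k : k \in s -> exists i, k = d 0 i.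
  by rewrite (perm_mem perm) => /mapP[i _ ->]; exists i.
have ds i : d 0 i \in s by rewrite (perm_mem perm); apply: map_f; rewrite mem_enum.
have hs : head 0 s \in s.
  by case: s {perm ss sd} ds => [/(_ (Ordinal n0)) //|a s _]; rewrite /= mem_head.
have Eprod : \prod_(k <- s) k = \prod_i d 0 i by rewrite (perm_big _ perm) big_map big_enum.
have head_le k : k \in s -> head 0 s <= k.
  case: s ss {perm sd ds hs Eprod} => [//|a s] /= ss.
  rewrite inE => /predU1P[->//|ks].
  by move: ss; rewrite (path_sortedE le_trans) => /andP[/allP /(_ _ ks)].
split=> //.
- by rewrite Eprod (diagonalized_det Pg Ph).
- by rewrite Eprod; apply: prodr_gt0.
- by have [i ->] := sd _ hs.
- move=> w; have [-> ->] := diagonalized_form Pg Ph w hpos.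
  rewrite mulr_sumr; apply: ler_sum => i _.
  by rewrite mulrCA -[leRHS]mulr1 ler_wpM2l ?sqr_ge0 // ler_pdivrMr // mul1r head_le.
Qed.

End Spectrum.

(** * Commuting coordinate vector fields *)

Section Frame.
Context {R : realType} {n : nat}.
Variables (U : set 'rV[R]_n) (y : 'I_n -> 'rV[R]_n -> R^o).

(** Rows are indexed by chart coordinates and columns by the functions [y], so the chart partials
    are this matrix times the derivatives with respect to [y]. *)
Definition jacobian_mx (u : 'rV[R]_n) : 'M[R]_n := \matrix_(k, i) partial k (y i) u.

(* the coordinate vector fields d/dy_i, written in the given chart *)
Definition frame (i : 'I_n) (f : 'rV[R]_n -> R^o) (u : 'rV[R]_n) : R^o :=
  \sum_k invmx (jacobian_mx u) i k * partial k f u.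

Hypotheses (oU : open U) (sy : forall i, smooth_fun U (y i)).
Hypothesis uJ : forall u, U u -> jacobian_mx u \in unitmx.

Local Notation D := frame.
Implicit Types (f g : 'rV[R]_n -> R^o) (u : 'rV[R]_n).

Lemma frame_coef_smooth i k : smooth_fun U (fun u => invmx (jacobian_mx u) i k).
Proof.
apply: (smooth_fun_invmx uJ) => k' i'.
by apply: smooth_fun_ext (smooth_fun_partial k' oU (sy i')) _ => u _; rewrite mxE.
Qed.

Lemma frame_smooth i f : smooth_fun U f -> smooth_fun U (D i f).
Proof.
move=> sf; apply: smooth_fun_sum => k.
exact: smooth_funM (frame_coef_smooth i k) (smooth_fun_partial k oU sf).
Qed.

Lemma frame_ext i f g u : (forall v, U v -> f v = g v) -> U u -> D i f u = D i g u.
Proof. by move=> fg Uu; apply: eq_bigr => k _; rewrite (partial_ext k oU Uu fg). Qed.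

Lemma frameD i f g u : smooth_fun U f -> smooth_fun U g -> U u ->
  D i (fun v => f v + g v) u = D i f u + D i g u.
Proof.
move=> sf sg Uu; rewrite /frame -big_split; apply: eq_bigr => k _.
by rewrite partialD ?mulrDr //; apply: smooth_fun_diff Uu.
Qed.

Lemma frameM i f g u : smooth_fun U f -> smooth_fun U g -> U u ->
  D i (fun v => f v * g v) u = D i f u * g u + f u * D i g u.
Proof.
move=> sf sg Uu; rewrite /frame mulr_suml mulr_sumr -big_split; apply: eq_bigr => k _.
rewrite partialM; [| exact: smooth_fun_diff sf Uu | exact: smooth_fun_diff sg Uu].
by rewrite /= mulrDr mulrA [in RHS]mulrCA.
Qed.

Lemma frame_cst i (c : R) u : D i (fun=> c) u = 0.
Proof. by rewrite /frame big1 // => k _; rewrite partial_cst mulr0. Qed.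

Lemma frame_ln i f u : smooth_fun U f -> U u -> 0 < f u ->
  D i (fun v => ln (f v)) u = D i f u / f u.
Proof.
move=> sf Uu f0; rewrite /frame mulr_suml; apply: eq_bigr => k _.
by rewrite partial_ln ?mulrA //; apply: smooth_fun_diff Uu.
Qed.

Lemma frame_sum (I : Type) (r : seq I) (F : I -> 'rV[R]_n -> R^o) i u :
  (forall k, smooth_fun U (F k)) -> U u ->
  D i (fun v => \sum_(k <- r) F k v) u = \sum_(k <- r) D i (F k) u.
Proof.
move=> sF Uu; rewrite /frame exchange_big /=; apply: eq_bigr => k _.
rewrite partial_sum ?mulr_sumr // => j; exact: smooth_fun_diff (sF j) Uu.
Qed.

Lemma frame_coord i j u : U u -> D i (y j) u = (i == j)%:R.
Proof.
move=> Uu; transitivity ((invmx (jacobian_mx u) *m jacobian_mx u) i j).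
  by rewrite mxE; apply: eq_bigr => k _; rewrite [in RHS]mxE.
by rewrite mulVmx ?mxE // uJ.
Qed.

(* [D i, D j] is a vector field without second-order part that annihilates the
   coordinates y, hence vanishes *)
Lemma frameC i j f u : smooth_fun U f -> U u -> D i (D j f) u = D j (D i f) u.
Proof.
move=> sf Uu.
pose G a k v : R := invmx (jacobian_mx v) a k.
have sG a k : smooth_fun U (G a k) by exact: frame_coef_smooth.
have sp g k : smooth_fun U g -> smooth_fun U (partial k g) by exact: smooth_fun_partial.
pose Z l := D i (G j l) u - D j (G i l) u.
have DD g : smooth_fun U g ->
    D i (D j g) u - D j (D i g) u = \sum_l Z l * partial l g u.
  move=> sg; have E a b : D a (D b g) u = \sum_l D a (G b l) u * partial l g u
      + \sum_l \sum_k G a k u * G b l u * partial k (partial l g) u.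
    rewrite {2}/frame frame_sum //; last by move=> l; apply: smooth_funM; [exact: sG | exact: sp].
    rewrite -big_split; apply: eq_bigr => l _ /=.
    rewrite (frameM _ (sG b l) (sp _ l sg) Uu).
    congr (_ + _) => //; rewrite /frame mulr_sumr; apply: eq_bigr => k _.
    by rewrite mulrA (mulrC (invmx _ b l)).
  rewrite !E [X in _ + X - _](_ : _ = \sum_l \sum_k G j k u * G i l u * partial k (partial l g) u).
    rewrite opprD addrACA subrr addr0 -sumrB.
    by apply: eq_bigr => l _; rewrite mulrBl.
  rewrite exchange_big; apply: eq_bigr => l _; apply: eq_bigr => k _.
  by rewrite (partialC _ _ oU sg Uu) (mulrC (G i l u)).
apply/eqP; rewrite -subr_eq0 DD //; apply/eqP.
have ZJ : (\row_l Z l) *m jacobian_mx u = 0.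
  apply/rowP => m; rewrite !mxE.
  transitivity (\sum_l Z l * partial l (y m) u).
    by apply: eq_bigr => l _; rewrite !mxE.
  rewrite -DD // (frame_ext i (g := fun=> (j == m)%:R)) //; last exact: frame_coord.
  rewrite (frame_ext j (g := fun=> (i == m)%:R)) //; last exact: frame_coord.
  by rewrite !frame_cst subrr.
have Z0 l : Z l = 0.
  have := congr1 (mulmxr (invmx (jacobian_mx u))) ZJ.
  by rewrite /= mulmxK ?uJ // mul0mx => /rowP/(_ l); rewrite !mxE.
by rewrite big1 // => l _; rewrite Z0 mul0r.
Qed.

(** [D i] has variable coefficients, so the second derivative test is applied to the constant field
    [v] that agrees with it at [u]. The iterated derivatives agree at [u] because their difference
    only carries first derivatives of [f], which vanish at a maximum. *)
Lemma frame_at_max i f u : smooth_fun U f -> U u -> (forall v, U v -> f v <= f u) ->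
  D i f u = 0 /\ D i (D i f) u <= 0.
Proof.
move=> sf Uu fmax.
pose v := row i (invmx (jacobian_mx u)).
have Dv g : smooth_fun U g -> 'D_v g u = D i g u.
  move=> sg; rewrite derive_partial; last exact: smooth_fun_diff sg Uu.
  by apply: eq_bigr => k _; rewrite mxE.
have sp k : smooth_fun U (partial k f) by exact: smooth_fun_partial.
have sd w : smooth_fun U ('D_w f).
  apply: (smooth_fun_ext (f := fun z => \sum_k w 0 k * partial k f z)).
    by apply: smooth_fun_sum => k; apply: smooth_funM; first exact: smooth_fun_cst.
  by move=> z Uz; rewrite derive_partial //; exact: smooth_fun_diff sf Uz.
have ndf : \forall z \near u, differentiable f z.
  by apply: (near_open oU Uu) => z Uz; exact: smooth_fun_diff sf Uz.
have nmax : \forall z \near u, f z <= f u by exact: (near_open oU Uu).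
have H w := second_derive_at_max ndf (smooth_fun_diff oU (sd w) Uu) nmax.
have p0 k : partial k f u = 0 by have [] := H (delta_mx 0 k).
split; first by rewrite -Dv //; have [] := H v.
suff -> : D i (D i f) u = 'D_v ('D_v f) u by have [] := H v.
rewrite (Dv _ (sd v)) (@frame_ext i ('D_v f) (fun z => \sum_k v 0 k * partial k f z)) //; last first.
  by move=> z Uz; rewrite derive_partial //; exact: smooth_fun_diff sf Uz.
have sG k := frame_coef_smooth i k.
rewrite {2}/frame !frame_sum //; last 2 first.
- by move=> k; apply: smooth_funM; first exact: smooth_fun_cst.
- by move=> k; apply: smooth_funM.
apply: eq_bigr => k _; rewrite frameM // frameM //; last exact: smooth_fun_cst.
by rewrite frame_cst p0 mulr0 mul0r !add0r mxE.
Qed.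

End Frame.

(** * Jacobi's formula and second-order jets along the frame *)

Section Jacobi.
Context {R : realType} {n : nat}.
Variables (U : set 'rV[R]_n) (y : 'I_n -> 'rV[R]_n -> R^o).
Hypotheses (oU : open U) (sy : forall i, smooth_fun U (y i)).
Hypothesis uJ : forall u, U u -> jacobian_mx y u \in unitmx.
Local Notation D := (frame y).

Lemma frame_prod (I : eqType) (r : seq I) (F : I -> 'rV[R]_n -> R^o) i u :
  uniq r -> (forall k, smooth_fun U (F k)) -> U u ->
  D i (fun v => \prod_(k <- r) F k v) u =
    \sum_(j <- r) D i (F j) u * \prod_(k <- r | j != k) F k u.
Proof.
move=> + sF Uu; elim: r => [|a r IH] /=.
  by rewrite big_nil -[RHS](frame_cst y i 1 u) => _; congr (frame _ _ _ _); apply/funext => v; rewrite big_nil.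
move=> /andP[ar ur].
rewrite (frame_ext y oU i (g := fun v => F a v * \prod_(k <- r) F k v)) //; last first.
  by move=> v _; rewrite big_cons.
rewrite (frameM y oU i (sF a)) //; last exact: smooth_fun_prod.
rewrite IH // !big_cons eqxx /=; congr (_ * _ + _).
  rewrite big_seq [RHS]big_seq_cond; apply: eq_bigl => k.
  by have [<-|_] := eqVneq a k; rewrite ?andbT ?andbF // (negPf ar).
rewrite mulr_sumr [LHS]big_seq [RHS]big_seq; apply: eq_bigr => j jr.
rewrite big_cons; have -> : j != a by apply: contraNneq ar => <-.
by rewrite mulrCA.
Qed.

(** Jacobi's formula: when the Leibniz expansion is differentiated, the permutations with s k = l
    add up to the cofactor of the entry (k, l). *)
Lemma frame_det m (A : 'rV[R]_n -> 'M[R]_m) i u :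
  (forall k l, smooth_fun U (fun v => A v k l)) -> U u ->
  D i (fun v => \det (A v)) u =
    \sum_k \sum_l cofactor (A u) k l * D i (fun v => A v k l) u.
Proof.
move=> sA Uu; pose c (s : {perm 'I_m}) : R := (-1) ^+ odd_perm s.
have sc s : smooth_fun U (fun=> c s) by exact: smooth_fun_cst.
rewrite (frame_ext y oU i (g := fun v => \sum_s c s * \prod_k A v k (s k))) //.
rewrite (frame_sum y oU) //; last by move=> s; apply: smooth_funM => //; apply: smooth_fun_prod.
transitivity (\sum_(s : {perm 'I_m}) \sum_k D i (fun v => A v k (s k)) u
   * (c s * \prod_(k' | k != k') A u k' (s k'))).
  apply: eq_bigr => s _; rewrite (frameM y oU) //; last exact: smooth_fun_prod.
  rewrite frame_cst mul0r add0r (frame_prod i (index_enum_uniq _)) // mulr_sumr.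
  by apply: eq_bigr => k _; rewrite mulrCA.
rewrite exchange_big; apply: eq_bigr => k _ /=.
rewrite (partition_big (fun s : {perm 'I_m} => s k) xpredT) //=.
apply: eq_bigr => l _; rewrite expand_cofactor mulr_suml.
by apply: eq_bigr => s /eqP sk; rewrite sk mulrC.
Qed.

(** The triple is the 2-jet of [f] at [u] along [D j]. The rules below compute the jet of a
    polynomial expression from those of its atoms and leave identities for [ring]. *)
Definition jet2 (f : 'rV[R]_n -> R^o) u j (t : R * R * R) : Prop :=
  [/\ smooth_fun U f, f u = t.1.1, D j f u = t.1.2 & D j (D j f) u = t.2].

Lemma jet2P f u j : smooth_fun U f -> jet2 f u j (f u, D j f u, D j (D j f) u).
Proof. by []. Qed.

Lemma jet2_eq f u j t t' : jet2 f u j t -> t = t' -> jet2 f u j t'.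
Proof. by move=> ? <-. Qed.

Lemma jet2_cst (c : R) u j : jet2 (fun=> c) u j (c, 0, 0).
Proof.
split=> //=; [exact: smooth_fun_cst | exact: frame_cst |].
rewrite -[RHS](frame_cst y j 0 u); congr (frame _ _ _ _).
by apply/funext => v; rewrite frame_cst.
Qed.

Lemma jet2_coord i j u : U u -> jet2 (y i) u j (y i u, (j == i)%:R, 0).
Proof.
move=> Uu; split=> //=; first exact: (frame_coord uJ).
rewrite (frame_ext y oU j (g := fun=> (j == i)%:R)) ?frame_cst // => v Uv.
exact: (frame_coord uJ).
Qed.

Lemma jet2D f g u j a b c a' b' c' : U u -> jet2 f u j (a, b, c) -> jet2 g u j (a', b', c') ->
  jet2 (fun v => f v + g v) u j (a + a', b + b', c + c').
Proof.
move=> Uu [/= sf <- <- <-] [/= sg <- <- <-]; split=> //=; first exact: smooth_funD.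
  exact: (frameD y oU).
rewrite (frame_ext y oU j (g := fun v => D j f v + D j g v)) //.
  by rewrite (frameD y oU) //; apply: frame_smooth.
by move=> v Uv; rewrite (frameD y oU).
Qed.

Lemma jet2M f g u j a b c a' b' c' : U u -> jet2 f u j (a, b, c) -> jet2 g u j (a', b', c') ->
  jet2 (fun v => f v * g v) u j (a * a', b * a' + a * b', c * a' + 2 * (b * b') + a * c').
Proof.
move=> Uu [/= sf <- <- <-] [/= sg <- <- <-].
have sDf := frame_smooth oU sy uJ j sf; have sDg := frame_smooth oU sy uJ j sg.
split=> //=; first exact: smooth_funM.
  exact: (frameM y oU).
rewrite (frame_ext y oU j (g := fun v => D j f v * g v + f v * D j g v)) //.
  rewrite (frameD y oU j (smooth_funM sDf sg) (smooth_funM sf sDg) Uu).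
  rewrite (frameM y oU j sDf sg Uu) (frameM y oU j sf sDg Uu).
  have E (p q r s t w : R) : p * q + r * s + (r * s + t * w) = p * q + 2 * (r * s) + t * w.
    by ring.
  exact: E.
by move=> v Uv; rewrite (frameM y oU).
Qed.

Lemma jet2_sum (I : Type) (r : seq I) (F : I -> 'rV[R]_n -> R^o) u j (a b c : I -> R) :
  U u -> (forall k, jet2 (F k) u j (a k, b k, c k)) ->
  jet2 (fun v => \sum_(k <- r) F k v) u j
    (\sum_(k <- r) a k, \sum_(k <- r) b k, \sum_(k <- r) c k).
Proof.
move=> Uu jF; elim: r => [|k r IH].
  rewrite !big_nil (_ : (fun _ => _) = fun=> 0); first exact: jet2_cst.
  by apply/funext => v; rewrite big_nil.
rewrite !big_cons (_ : (fun _ => _) = fun v => F k v + \sum_(l <- r) F l v).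
  exact: jet2D.
by apply/funext => v; rewrite big_cons.
Qed.

End Jacobi.

(** * The maximum principle *)

(** These are the terms of an index k <> 1 in the final sum, with b0 = b_1, b = b_k, x = <F, E_k>
    and t = D_k W_11. Once [t] and [a] are eliminated, the quotients b0 / b and b / b0 cancel, and
    the right side exceeds the left by 2 al th (1 - th) x^2. *)
Lemma offdiagonal_term (R : realFieldType) (al th s b0 b x t a : R) :
  0 < s -> 0 < b0 -> 0 < b -> 0 < al -> 0 < th < 1 ->
  s * t = x * (th * b - b0) -> s * a = - (th * x) ->
  th * x ^+ 2 <= 2 * al * s * (x * t / b) + th * x ^+ 2 +
    (al * s ^+ 2 * (2 * t ^+ 2 / (b0 * b)) +
     al * s ^+ 2 / b0 * (4 * a * t + 2 * a ^+ 2 * b - 2 * b0 * a ^+ 2)).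
Proof.
move=> s0 b00 b0' al0 /andP[th0 th1] Et Ea.
have -> : 2 * al * s * (x * t / b) + th * x ^+ 2 +
    (al * s ^+ 2 * (2 * t ^+ 2 / (b0 * b)) +
     al * s ^+ 2 / b0 * (4 * a * t + 2 * a ^+ 2 * b - 2 * b0 * a ^+ 2)) =
  2 * al * x * (s * t) / b + th * x ^+ 2 + (al * (2 * (s * t) ^+ 2 / (b0 * b)) +
     al / b0 * (4 * (s * a) * (s * t) + 2 * (s * a) ^+ 2 * b - 2 * b0 * (s * a) ^+ 2)).
  by field; rewrite !gt_eqF.
rewrite Et Ea.
have -> : 2 * al * x * (x * (th * b - b0)) / b + th * x ^+ 2 +
    (al * (2 * (x * (th * b - b0)) ^+ 2 / (b0 * b)) +
     al / b0 * (4 * - (th * x) * (x * (th * b - b0)) + 2 * (- (th * x)) ^+ 2 * b -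
       2 * b0 * (- (th * x)) ^+ 2)) = th * x ^+ 2 + 2 * al * (th * (1 - th)) * x ^+ 2.
  by field; rewrite !gt_eqF.
rewrite lerDl mulr_ge0 ?sqr_ge0 // mulr_ge0 //; first by rewrite mulr_ge0 // ltW.
by rewrite mulr_ge0 ?ltW // subr_gt0.
Qed.

(** The algebra at p0, with t j = D_j W_11, M k l = D_1 W_kl, T j i = D_i W_jj and q j = D_1 D_1
    W_jj. The value of [s * t j] comes from D_j Phi = 0, the two equations with sums over 1 / b_j
    come from the Monge-Ampere equation, and the last hypothesis is D_j D_j Phi <= 0. The weights al
    / b_j are those of the linearized Monge-Ampere operator: with them the second derivatives [q] of
    W add up to a sum known from the twice differentiated equation. *)
Lemma umbilic_inequality (R : realFieldType) (n : nat) (i0 : 'I_n) (al th s : R)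
    (b x t q a : 'I_n -> R) (M T : 'I_n -> 'I_n -> R) :
  (2 <= n)%N -> 0 < al -> 0 < th -> n%:R * al * th = n%:R * al - 1 ->
  0 < s -> (forall i, 0 < b i) -> (forall i, b i <= b i0) ->
  a i0 = 0 -> (forall k, k != i0 -> s * a k = - (th * x k)) ->
  (forall j, s * t j = x j * (th * b j - b i0)) ->
  (forall j, M j i0 = t j) -> (forall j, M i0 j = t j) ->
  (forall i, al * s * (\sum_j T j i / b j) + x i = 0) ->
  al * x i0 * (\sum_j T j i0 / b j) + al * s * (\sum_j q j / b j
    - \sum_k \sum_l M k l ^+ 2 / (b k * b l)) + b i0 + ((n%:R + 2) * al - 1) * s = 0 ->
  (forall j, b j * b i0 + 2 * x j * t j + s * q j +
      (j == i0)%:R * s * (\sum_k (4 * a k * t k + 2 * a k ^+ 2 * b k - 2 * b i0 * a k ^+ 2) + 2 * b i0)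
      - th * (b j ^+ 2 + \sum_i x i * T j i - s * b j) <= 0) ->
  (forall i, x i = 0) /\ (forall i, b i = b i0).
Proof.
move=> n2 al0 th0 Eth s0 b0 bmax a0 Ea Et Mr Ml P1 P2 second.
have th1 : th < 1.
  have n0 : 0 < n%:R * al by rewrite mulr_gt0 // ltr0n; apply: leq_trans n2.
  by rewrite -(ltr_pM2l n0) Eth mulr1; lra.
have nz k : b k != 0 by rewrite gt_eqF.
pose E := \sum_k (4 * a k * t k + 2 * a k ^+ 2 * b k - 2 * b i0 * a k ^+ 2).
pose A1 := \sum_j x j * t j / b j.
pose Q := \sum_j q j / b j.
pose m2 := \sum_k \sum_l M k l ^+ 2 / (b k * b l).
pose Y := \sum_j (\sum_i x i * T j i) / b j.
have sum_le : n%:R * al * b i0 + 2 * al * A1 + al * s * Q + al * s / b i0 * (E + 2 * b i0)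
   - al * th * (\sum_j b j) - al * th * Y + al * th * s * n%:R <= 0.
  have : \sum_j al / b j * (b j * b i0 + 2 * x j * t j + s * q j +
      (j == i0)%:R * s * (E + 2 * b i0)
      - th * (b j ^+ 2 + \sum_i x i * T j i - s * b j)) <= 0.
    by apply: sumr_le0 => j _; rewrite pmulr_rle0 ?second // divr_gt0.
  congr (_ <= _).
  have Ed : \sum_j (j == i0)%:R * (al * s / b j * (E + 2 * b i0)) = al * s / b i0 * (E + 2 * b i0).
    by rewrite (bigD1 i0) //= eqxx mul1r big1 ?addr0 // => j /negPf ->; rewrite mul0r.
  transitivity (\sum_j (al * b i0 + 2 * al * (x j * t j / b j) + al * s * (q j / b j)
     + (j == i0)%:R * (al * s / b j * (E + 2 * b i0)) - al * th * b j
     - al * th * ((\sum_i x i * T j i) / b j) + al * th * s)).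
    by apply: eq_bigr => j _; field.
  have S1 : \sum_j 2 * al * (x j * t j / b j) = 2 * al * A1 by rewrite mulr_sumr.
  have S2 : \sum_j al * s * (q j / b j) = al * s * Q by rewrite mulr_sumr.
  have S3 : \sum_j al * th * b j = al * th * \sum_j b j by rewrite mulr_sumr.
  have S4 : \sum_j al * th * ((\sum_i x i * T j i) / b j) = al * th * Y by rewrite mulr_sumr.
  have S5 (c : R) : \sum_(j < n) c = n%:R * c by rewrite sumr_const card_ord mulr_natl.
  by rewrite !big_split /= !sumrN S1 S2 S3 S4 Ed !S5; ring.
(* The once differentiated equation removes the third derivatives of s that |F|^2 brings in. *)
have EY : al * s * Y = - \sum_j x j ^+ 2.
  rewrite /Y (eq_bigr (fun j => \sum_i x i * (T j i / b j))); last first.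
    by move=> j _; rewrite mulr_suml; apply: eq_bigr => i _; rewrite mulrA.
  rewrite exchange_big mulr_sumr -sumrN; apply: eq_bigr => i _ /=.
  rewrite -mulr_sumr mulrCA.
  have -> : al * s * (\sum_j T j i / b j) = - x i by have := P1 i; lra.
  by rewrite mulrN expr2.
(* Only the row and the column of index i0 are kept, without their common entry; both equal [t],
   whence the factor 2. *)
have m2_ge : \sum_(j | j != i0) 2 * t j ^+ 2 / (b i0 * b j) <= m2.
  have pos k l : 0 <= M k l ^+ 2 / (b k * b l) by rewrite divr_ge0 ?sqr_ge0 ?mulr_ge0 ?ltW.
  rewrite /m2 [leRHS](bigD1 i0) //= [X in _ <= X + _](bigD1 i0) //= -addrA.
  apply: ler_wpDl => //.
  have -> : \sum_(j | j != i0) 2 * t j ^+ 2 / (b i0 * b j) =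
     \sum_(j | j != i0) t j ^+ 2 / (b i0 * b j) + \sum_(j | j != i0) t j ^+ 2 / (b i0 * b j).
    by rewrite -big_split; apply: eq_bigr => j _ /=; rewrite -mulrA mulr_natl mulr2n.
  apply: lerD; first by apply: ler_sum => j _; rewrite Ml.
  apply: ler_sum => k ki; rewrite (bigD1 i0) //= Mr (mulrC (b k)) lerDl.
  by apply: sumr_ge0.
have x0E : s * t i0 = - (x i0 * b i0 * (1 - th)) by rewrite Et; ring.
have main : al * th * s * (\sum_j (b i0 - b j)) + th * \sum_j x j ^+ 2 <= 0.
  apply: le_trans (_ : s * (n%:R * al * b i0 + 2 * al * A1 + al * s * Q + al * s / b i0 * (E + 2 * b i0)
   - al * th * (\sum_j b j) - al * th * Y + al * th * s * n%:R) <= 0); last first.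
    by rewrite pmulr_rle0.
  have tr : al * s * (\sum_j T j i0 / b j) = - x i0 by have := P1 i0; lra.
  have EQ : s * (al * s * Q) = al * s ^+ 2 * m2 + x i0 ^+ 2 - s * b i0 - ((n%:R + 2) * al - 1) * s ^+ 2.
    have := congr1 ( *%R s) P2; rewrite -/Q -/m2 mulr0.
    have -> : s * (al * x i0 * (\sum_j T j i0 / b j) + al * s * (Q - m2) + b i0 + ((n%:R + 2) * al - 1) * s)
      = x i0 * (al * s * (\sum_j T j i0 / b j)) + s * (al * s * Q) - al * s ^+ 2 * m2 + s * b i0 + ((n%:R + 2) * al - 1) * s ^+ 2 by ring.
    by rewrite tr; lra.
  have -> : s * (n%:R * al * b i0 + 2 * al * A1 + al * s * Q + al * s / b i0 * (E + 2 * b i0)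
   - al * th * (\sum_j b j) - al * th * Y + al * th * s * n%:R)
    = s * (al * s * Q) + s * n%:R * al * b i0 + 2 * al * s * A1 + al * s ^+ 2 / b i0 * E + 2 * al * s ^+ 2
      - al * th * s * (\sum_j b j) - th * (al * s * Y) + (n%:R * al * th) * s ^+ 2 by field.
  rewrite EQ EY Eth sumrB sumr_const card_ord -[b i0 *+ n]mulr_natr.
  have -> : al * th * s * (b i0 * n%:R - \sum_j b j) = (n%:R * al * th) * s * b i0 - al * th * s * (\sum_j b j) by ring.
  rewrite Eth.
  suff : th * \sum_j x j ^+ 2 <= al * s ^+ 2 * m2 + x i0 ^+ 2 + 2 * al * s * A1
      + al * s ^+ 2 / b i0 * E + th * \sum_j x j ^+ 2 by lra.
  apply: le_trans (_ : al * s ^+ 2 * (\sum_(j | j != i0) 2 * t j ^+ 2 / (b i0 * b j)) + x i0 ^+ 2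
     + 2 * al * s * A1 + al * s ^+ 2 / b i0 * E + th * \sum_j x j ^+ 2 <= _); last first.
    rewrite !lerD2r ler_wpM2l // mulr_ge0 ?sqr_ge0 // ltW //.
  rewrite /A1 /E !mulr_sumr.
  have D1 (G : 'I_n -> R) : \sum_j G j = G i0 + \sum_(j | j != i0) G j by rewrite (bigD1 i0).
  rewrite (D1 (fun j => th * x j ^+ 2)) (D1 (fun j => 2 * al * s * (x j * t j / b j))).
  rewrite (D1 (fun j => al * s ^+ 2 / b i0 * (4 * a j * t j + 2 * a j ^+ 2 * b j - 2 * b i0 * a j ^+ 2))).
  rewrite a0 !(mulr0, mul0r, expr0n) /= !(mulr0, mul0r, addr0, subr0).
  (* At index i0 the variation [a] vanishes. Since n al (1 - th) = 1, n >= 2 gives 2 al (1 - th) <=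
     1, and the term x_1^2 supplied by the twice differentiated equation absorbs the negative
     one. *)
  have h0 : th * x i0 ^+ 2 <= x i0 ^+ 2 + 2 * al * s * (x i0 * t i0 / b i0) + th * x i0 ^+ 2.
    have -> : 2 * al * s * (x i0 * t i0 / b i0) = 2 * al * x i0 * (s * t i0) / b i0 by field.
    rewrite x0E.
    have -> : 2 * al * x i0 * - (x i0 * b i0 * (1 - th)) / b i0 = - (2 * (al * (1 - th))) * x i0 ^+ 2 by field.
    rewrite lerDr -{1}[x i0 ^+ 2]mul1r -mulrDl mulr_ge0 ?sqr_ge0 //.
    have : 2 * (al * (1 - th)) <= n%:R * (al * (1 - th)).
      by rewrite ler_wpM2r ?ler_nat // mulr_ge0 ?subr_ge0 // ltW.
    lra.
  have hk : \sum_(j | j != i0) th * x j ^+ 2 <= \sum_(j | j != i0)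
     (2 * al * s * (x j * t j / b j) + th * x j ^+ 2 +
    (al * s ^+ 2 * (2 * t j ^+ 2 / (b i0 * b j)) +
     al * s ^+ 2 / b i0 * (4 * a j * t j + 2 * a j ^+ 2 * b j - 2 * b i0 * a j ^+ 2))).
    by apply: ler_sum => j ji; apply: offdiagonal_term => //; [rewrite th0 | exact: Ea].
  rewrite !big_split /= in hk.
  lra.
have sb : 0 <= \sum_j (b i0 - b j) by apply: sumr_ge0 => j _; rewrite subr_ge0.
have sx : 0 <= \sum_j x j ^+ 2 by apply: sumr_ge0 => j _; exact: sqr_ge0.
have c1 : 0 < al * th * s by rewrite !mulr_gt0.
have m1 : 0 <= al * th * s * (\sum_j (b i0 - b j)) by rewrite mulr_ge0 // ltW.
have m2' : 0 <= th * \sum_j x j ^+ 2 by rewrite mulr_ge0 // ltW.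
split=> i.
  have /eqP : th * \sum_j x j ^+ 2 = 0 by lra.
  rewrite mulf_eq0 (gt_eqF th0) /= psumr_eq0; last by move=> *; exact: sqr_ge0.
  by move=> /allP/(_ i (mem_index_enum _)) /=; rewrite sqrf_eq0 => /eqP.
have /eqP : al * th * s * (\sum_j (b i0 - b j)) = 0 by lra.
rewrite mulf_eq0 (gt_eqF c1) /= psumr_eq0; last by move=> *; rewrite subr_ge0.
by move=> /allP/(_ i (mem_index_enum _)) /=; rewrite subr_eq0 => /eqP.
Qed.

Lemma sum_delta (R : pzSemiRingType) (n : nat) (i : 'I_n) (F : 'I_n -> R) :
  \sum_k (i == k)%:R * F k = F i.
Proof.
rewrite (bigD1 i) //= eqxx mul1r big1 ?addr0 // => k; rewrite eq_sym => /negPf ->.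
by rewrite mul0r.
Qed.

(** * The Monge-Ampere equation in slope coordinates *)

Section MongeAmpere.
Context {R : realType} {n : nat}.
Variables (U : set 'rV[R]_n) (y : 'I_n -> 'rV[R]_n -> R^o).
Hypotheses (oU : open U) (sy : forall i, smooth_fun U (y i)).
Hypothesis uJ : forall u, U u -> jacobian_mx y u \in unitmx.
Local Notation D := (frame y).

Variables (s : 'rV[R]_n -> R^o) (x : 'I_n -> 'rV[R]_n -> R^o).
Variables (W : 'rV[R]_n -> 'M[R]_n) (al : R).
Hypotheses (ss : smooth_fun U s) (s_gt0 : forall u, U u -> 0 < s u).
Hypothesis sW : forall i j, smooth_fun U (fun u => W u i j).
Hypothesis Ds : forall i u, U u -> D i s u = x i u.
Hypothesis det_gt0 : forall u, U u -> 0 < \det (W u).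

Local Notation Y u := (\sum_k y k u * y k u).
Local Notation V u := (invmx (W u)).

(** The logarithm of s = rho K^al with K = 1 / (rho^(n+2) det W), where ln rho is half of ln (1 +
    |y|^2). *)
Hypothesis monge_ampere : forall u, U u ->
  al * ln (\det (W u)) + ln (s u) + ((n%:R + 2) * al - 1) / 2 * ln (1 + Y u) = 0.

Lemma sqr_coord_smooth : smooth_fun U (fun u => Y u).
Proof. by apply: smooth_fun_sum => k; apply: smooth_funM. Qed.

Lemma sqr_coord1_gt0 u : 0 < 1 + Y u.
Proof. by rewrite ltr_wpDr // sumr_ge0 // => k _; rewrite -expr2 sqr_ge0. Qed.

Lemma hess_unitmx u : U u -> W u \in unitmx.
Proof. by move=> /det_gt0 d0; rewrite unitmxE unitfE gt_eqF. Qed.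

(** Jacobi's formula makes the derivative of ln det W the trace of W^-1 D_i W. Multiplication by [s]
    clears the quotient D_i s / s before the next differentiation. *)
Lemma monge_ampere_deriv i u : U u ->
  al * (s u * \sum_k \sum_l V u l k * D i (fun v => W v k l) u) + x i u
   + ((n%:R + 2) * al - 1) * (s u * (y i u * (1 + Y u)^-1)) = 0.
Proof.
move=> Uu; have s0 := s_gt0 Uu.
have sd : smooth_fun U (fun v => \det (W v)) by apply: smooth_fun_det.
have sY1 : smooth_fun U (fun v => 1 + Y v) by apply: smooth_funD; [exact: smooth_fun_cst | exact: sqr_coord_smooth].
have Yp v : U v -> 0 < 1 + Y v by move=> _; exact: sqr_coord1_gt0.
have sln1 := smooth_fun_ln sd det_gt0.
have sln2 := smooth_fun_ln ss s_gt0.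
have sln3 := smooth_fun_ln sY1 Yp.
have sc (c : R) : smooth_fun U (fun=> c) by exact: smooth_fun_cst.
have : D i (fun v => al * ln (\det (W v)) + ln (s v)
    + ((n%:R + 2) * al - 1) / 2 * ln (1 + Y v)) u = 0.
  by rewrite (frame_ext y oU i (g := fun=> 0)) ?frame_cst.
rewrite (frameD y oU i (smooth_funD (smooth_funM (sc al) sln1) sln2) (smooth_funM (sc _) sln3) Uu).
rewrite (frameD y oU i (smooth_funM (sc al) sln1) sln2 Uu).
rewrite (frameM y oU i (sc al) sln1 Uu) (frameM y oU i (sc _) sln3 Uu) !frame_cst.
rewrite (frame_ln y oU i sd Uu (det_gt0 Uu)) (frame_ln y oU i ss Uu s0).
rewrite (frame_ln y oU i sY1 Uu (Yp _ Uu)) (frame_det y oU i sW Uu).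
have -> : D i (fun v => 1 + Y v) u = 2 * y i u.
  rewrite (frameD y oU i (sc 1) sqr_coord_smooth Uu) frame_cst add0r (frame_sum y oU) //; last first.
    by move=> k; apply: smooth_funM.
  transitivity (\sum_k (i == k)%:R * (2 * y k u)); last exact: sum_delta.
  apply: eq_bigr => k _; rewrite (frameM y oU i (sy k) (sy k) Uu) (frame_coord uJ) //.
  have E (p q : R) : p * q + q * p = p * (2 * q) by ring.
  exact: E.
have -> : (\sum_k \sum_l cofactor (W u) k l * D i (fun v => W v k l) u) / \det (W u) =
    \sum_k \sum_l V u l k * D i (fun v => W v k l) u.
  rewrite mulr_suml; apply: eq_bigr => k _; rewrite mulr_suml; apply: eq_bigr => l _.
  by rewrite /invmx hess_unitmx // !mxE mulrC mulrA.
rewrite (Ds i Uu).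
move: (\sum_k \sum_l _) => S; move: (Yp u Uu); move: (\sum_k _) => Z Y10.
rewrite !mul0r !add0r => E.
have {E} := congr1 ( *%R (s u)) E; rewrite mulr0 => <-.
by field; rewrite !gt_eqF.
Qed.

End MongeAmpere.

(** * The test function Phi and its 2-jet at the maximum *)

Section TestFunction.
Context {R : realType} {n : nat}.
Variables (U : set 'rV[R]_n) (y : 'I_n -> 'rV[R]_n -> R^o).
Hypotheses (oU : open U) (sy : forall i, smooth_fun U (y i)).
Hypothesis uJ : forall u, U u -> jacobian_mx y u \in unitmx.
Local Notation D := (frame y).

(* x, W and V stand for the gradient, the Hessian and the inverse Hessian of s
   in the frame *)
Variables (z0 : 'rV[R]_n) (al : R) (b : 'I_n -> R).
Variables (s Y : 'rV[R]_n -> R^o) (x : 'I_n -> 'rV[R]_n -> R^o).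
Variables (W V : 'I_n -> 'I_n -> 'rV[R]_n -> R^o).
Hypotheses (Uz0 : U z0) (y0 : forall i, y i z0 = 0).
Hypotheses (ss : smooth_fun U s) (sx : forall i, smooth_fun U (x i)).
Hypotheses (sW : forall i j, smooth_fun U (W i j)) (sV : forall i j, smooth_fun U (V i j)).
Hypotheses (sY : smooth_fun U Y) (Y0 : Y z0 = 0) (Y1_gt0 : forall u, 0 < 1 + Y u).
Hypothesis Ds : forall i u, U u -> D i s u = x i u.
Hypothesis Dx : forall i j u, U u -> D i (x j) u = W i j u.
Hypothesis WV : forall l k u, U u -> \sum_m W l m u * V m k u = (l == k)%:R.
Hypothesis hess0 : forall i j, W i j z0 = (i == j)%:R * b i.
Hypothesis b_gt0 : forall i, 0 < b i.
Hypothesis pde : forall i u, U u ->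
  al * (s u * \sum_k \sum_l V l k u * D i (W k l) u) + x i u
   + ((n%:R + 2) * al - 1) * (s u * (y i u * (1 + Y u)^-1)) = 0.

Let Wsym i j u : U u -> W i j u = W j i u.
Proof.
move=> Uu; rewrite -(Dx i j Uu) -(Dx j i Uu).
transitivity (D i (D j s) u); first by apply: (frame_ext y oU i _ Uu) => v Uv; rewrite Ds.
rewrite (frameC oU sy uJ i j ss Uu).
by apply: (frame_ext y oU j _ Uu) => v; exact: Ds.
Qed.

Let Wext k i j u : U u -> D k (W i j) u = D k (W j i) u.
Proof. by move=> Uu; apply: (frame_ext y oU k _ Uu) => v; exact: Wsym. Qed.

Let WC i j k u : U u -> D k (W i j) u = D j (W i k) u.
Proof.
move=> Uu; rewrite (Wext k i j Uu) (Wext j i k Uu).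
transitivity (D k (D j (x i)) u).
  by apply: (frame_ext y oU k _ Uu) => v Uv; rewrite Dx.
rewrite (frameC oU sy uJ k j (sx i) Uu).
by apply: (frame_ext y oU j _ Uu) => v; exact: Dx.
Qed.

(** Both sides are fourth derivatives of [s] along commuting fields, so no curvature terms appear.
    This identifies D_j D_j W_11, produced by the test function, with D_1 D_1 W_jj, produced by the
    Monge-Ampere equation. *)
Let WC4 i j u : U u -> D j (D j (W i i)) u = D i (D i (W j j)) u.
Proof.
move=> Uu.
transitivity (D j (D i (W i j)) u).
  by apply: (frame_ext y oU j _ Uu) => v; exact: WC.
transitivity (D i (D j (W i j)) u); first exact: (frameC oU sy uJ j i (sW i j)).
apply: (frame_ext y oU i _ Uu) => v Uv; rewrite (Wext j i j Uv); exact: WC.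
Qed.

Let bn0 k : b k != 0. Proof. by rewrite gt_eqF. Qed.

Let V0 k l : V k l z0 = (k == l)%:R / b k.
Proof.
have := WV k l Uz0; rewrite (eq_bigr (fun m => (k == m)%:R * (b k * V m l z0))); last first.
  by move=> m _; rewrite hess0 mulrA.
by rewrite sum_delta => <-; rewrite mulrC mulKf.
Qed.

(** The identity W V = 1 is differentiated at a point where W is diagonal. This is the source of the
    squares of third derivatives in [monge_ampere_deriv2]. *)
Let DV i l k : D i (V l k) z0 = - (D i (W l k) z0 / (b l * b k)).
Proof.
have sWV m : smooth_fun U (fun u => W l m u * V m k u) by apply: smooth_funM.
have : D i (fun u => \sum_m W l m u * V m k u) z0 = 0.
  rewrite (frame_ext y oU i (g := fun=> (l == k)%:R)) ?frame_cst // => u Uu.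
  exact: WV.
rewrite (frame_sum y oU _ i sWV Uz0).
rewrite (eq_bigr (fun m => (k == m)%:R * (D i (W l m) z0 / b m) +
    (l == m)%:R * (b l * D i (V m k) z0))); last first.
  move=> m _. rewrite (frameM y oU i (sW l m) (sV m k) Uz0).
rewrite V0.
rewrite hess0.
rewrite (eq_sym m).
  by congr (_ + _); [exact: mulrCA | rewrite -mulrA].
rewrite big_split /= !sum_delta => /eqP; rewrite addrC addr_eq0 => /eqP E.
apply: (mulfI (bn0 l)); rewrite E; field; by rewrite !bn0.
Qed.

Let trace i : \sum_k \sum_l V l k z0 * D i (W k l) z0 = \sum_k D i (W k k) z0 / b k.
Proof.
apply: eq_bigr => k _; transitivity (\sum_l (k == l)%:R * (D i (W k l) z0 / b l)).
  apply: eq_bigr => l _; rewrite V0 eq_sym.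
  have E (p q r : R) : p / q * r = p * (r / q) by ring.
  exact: E.
exact: sum_delta.
Qed.

Lemma monge_ampere_deriv1 i : al * s z0 * (\sum_k D i (W k k) z0 / b k) + x i z0 = 0.
Proof.
have := pde i Uz0; rewrite trace y0 mul0r !mulr0 addr0 => E.
by rewrite -[RHS]E mulrA.
Qed.

Lemma monge_ampere_deriv2 i :
  al * x i z0 * (\sum_k D i (W k k) z0 / b k) + al * s z0 * (\sum_k D i (D i (W k k)) z0 / b k
    - \sum_k \sum_l D i (W k l) z0 ^+ 2 / (b k * b l)) + b i + ((n%:R + 2) * al - 1) * s z0 = 0.
Proof.
have sc (c : R) : smooth_fun U (fun=> c) by exact: smooth_fun_cst.
have sDW j k l : smooth_fun U (D j (W k l)) by exact: (frame_smooth oU sy uJ j (sW k l)).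
have sVDW k l : smooth_fun U (fun u => V l k u * D i (W k l) u) by apply: smooth_funM.
pose S u := \sum_k \sum_l V l k u * D i (W k l) u.
have sS : smooth_fun U S by do 2!apply: smooth_fun_sum => ?.
pose I u := (1 + Y u)^-1.
have sI : smooth_fun U I.
  by apply: smooth_funV => [|u _]; [exact: smooth_funD | rewrite gt_eqF].
have sIy : smooth_fun U (fun u => y i u * I u) by apply: smooth_funM.
have : D i (fun u => al * (s u * S u) + x i u + ((n%:R + 2) * al - 1) * (s u * (y i u * I u))) z0 = 0.
  by rewrite (frame_ext y oU i (g := fun=> 0)) ?frame_cst // => u; exact: pde.
have ssS := smooth_funM ss sS; have ssI := smooth_funM ss sIy.
rewrite (frameD y oU i (smooth_funD (smooth_funM (sc al) ssS) (sx i)) (smooth_funM (sc _) ssI) Uz0).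
rewrite (frameD y oU i (smooth_funM (sc al) ssS) (sx i) Uz0).
rewrite (frameM y oU i (sc al) ssS Uz0) (frameM y oU i (sc _) ssI Uz0) !frame_cst.
rewrite (frameM y oU i ss sS Uz0) (frameM y oU i ss sIy Uz0) (frameM y oU i (sy i) sI Uz0).
rewrite (frame_coord uJ) // y0 eqxx /I Y0 addr0 invr1 (Ds i Uz0) (Dx i i Uz0) hess0 eqxx.
have -> : D i S z0 = \sum_k D i (D i (W k k)) z0 / b k - \sum_k \sum_l D i (W k l) z0 ^+ 2 / (b k * b l).
  rewrite /S (frame_sum y oU) //; last by move=> k; apply: smooth_fun_sum.
  rewrite -sumrB; apply: eq_bigr => k _; rewrite (frame_sum y oU) //.
  rewrite (eq_bigr (fun l => (k == l)%:R * (D i (D i (W k l)) z0 / b l) - D i (W k l) z0 ^+ 2 / (b k * b l))).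
    by rewrite sumrB sum_delta.
  move=> l _; rewrite (frameM y oU i (sV l k) (sDW i k l) Uz0) V0 DV (Wext i l k Uz0) eq_sym.
  have E (p q r t c : R) : - (p / (q * r)) * p + t / q * c = t * (c / q) - p ^+ 2 / (r * q).
    by rewrite (mulrC q r) expr2; ring.
  exact: E.
rewrite /S trace.
rewrite [true%:R]mulr1n.
move: (\sum_k D i (W k k) z0 / b k) (_ - \sum_k _) (x i z0) (s z0) => t1 t2 xi sz E.
rewrite -[RHS]E !mul0r !mulr0 !mulr1 mul1r !add0r addr0; ring.
Qed.

Variables (th C0 : R) (i0 : 'I_n).
Hypotheses (n2 : (2 <= n)%N) (al0 : 0 < al) (th0 : 0 < th).
Hypothesis Eth : n%:R * al * th = n%:R * al - 1.
Hypotheses (s0 : 0 < s z0) (bmax : forall i, b i <= b i0).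

(** By Legendre duality [m] is the height over the tangent plane, so the bracket in [C] is |F|^2; in
    the application [C0] is w(p0). Differences are written with a factor -1 so that only the jets of
    sums and products are needed. *)
Let m u := \sum_i x i u * y i u + (-1) * s u.
Let C u := C0 + th / 2 * (\sum_i x i u * x i u + m u * m u).

Hypothesis maxW : forall u, U u -> forall zeta : 'I_n -> R,
  s u * (\sum_k \sum_l zeta k * zeta l * W k l u) <=
  C u * (\sum_k zeta k ^+ 2 - (\sum_k zeta k * y k u) ^+ 2 * (1 - Y u)).
Hypothesis maxW0 : C z0 = s z0 * b i0.

(** The zero entry makes the correction y_1 a orthogonal to e_1, whence |zeta|^2 = 1 + y_1^2
    |a|^2. *)
Let a k := if k == i0 then 0 else - (th * x k z0 / s z0).
Let A := \sum_k a k ^+ 2.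
(** [f1] and [f2] are the two sides of [maxW] at zeta = e_1 + y_1 a, expanded in y_1. As <zeta, y> =
    y_1 (1 + <a, y>) has the factor y_1, the second derivatives at z0 involve [B] and [H] only
    through their values, and [L] only through its first derivative. *)
Let L u := \sum_k a k * W i0 k u.
Let B u := \sum_k \sum_l a k * a l * W k l u.
Let H u := A + (-1) * ((1 + \sum_k a k * y k u) * (1 + \sum_k a k * y k u) * (1 + (-1) * Y u)).
Let f1 u := s u * (W i0 i0 u + (2 * (y i0 u * L u) + y i0 u * y i0 u * B u)).
Let f2 u := C u * (1 + y i0 u * y i0 u * H u).
Let Phi u := f1 u + (-1) * f2 u.

Let Phi_le0 u : U u -> Phi u <= 0.
Proof.
move=> Uu; rewrite /Phi mulN1r subr_le0.
pose c := y i0 u; pose z k := (i0 == k)%:R + c * a k.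
have za k : (i0 == k)%:R * a k = 0.
  by rewrite /a eq_sym; case: eqP; rewrite ?mulr0 ?mul0r.
have := maxW Uu z; congr (_ <= _).
- congr (_ * _).
  transitivity (\sum_k (i0 == k)%:R * (\sum_l (i0 == l)%:R * W k l u)
    + (c * \sum_k (i0 == k)%:R * (\sum_l a l * W k l u)
    + (c * \sum_k a k * (\sum_l (i0 == l)%:R * W k l u) + c * c * B u))).
    rewrite /B !mulr_sumr -!big_split /=; apply: eq_bigr => k _.
    rewrite !mulr_sumr -!big_split /=; apply: eq_bigr => l _.
    by rewrite /z; ring.
  rewrite !sum_delta -/(L u).
  have -> : \sum_k a k * (\sum_l (i0 == l)%:R * W k l u) = L u.
    by apply: eq_bigr => k _; rewrite sum_delta Wsym.
  by rewrite -/c; move: (L u) (B u) (W i0 i0 u) => p q r; ring.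
congr (_ * _).
transitivity (\sum_k ((i0 == k)%:R * (i0 == k)%:R + c * c * a k ^+ 2)
   - (\sum_k ((i0 == k)%:R * y k u + c * (a k * y k u))) ^+ 2 * (1 - Y u)).
  congr (_ - _ ^+ 2 * _); apply: eq_bigr => k _; rewrite /z; last by rewrite mulrDl mulrA.
  have -> : ((i0 == k)%:R + c * a k) ^+ 2 =
    (i0 == k)%:R * (i0 == k)%:R + c * c * a k ^+ 2 + 2 * c * ((i0 == k)%:R * a k) by ring.
  by rewrite za mulr0 addr0.
rewrite !big_split /= !sum_delta -!mulr_sumr eqxx -/A /H -/c.
move: (\sum_k a k * y k u) (Y u) => p q; rewrite [true%:R]mulr1n; ring.
Qed.

Let t j : R := D j (W i0 i0) z0.
Let T j i : R := D i (W j j) z0.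
Let q j : R := D i0 (D i0 (W j j)) z0.

Let sc (c : R) : smooth_fun U (fun=> c). Proof. exact: smooth_fun_cst. Qed.

Let L0 : L z0 = 0.
Proof.
transitivity (\sum_k (i0 == k)%:R * (a k * b i0)).
  by apply: eq_bigr => k _; rewrite hess0 mulrCA.
by rewrite sum_delta /a eqxx mul0r.
Qed.

Let B0 : B z0 = \sum_k a k ^+ 2 * b k.
Proof.
apply: eq_bigr => k _; transitivity (\sum_l (k == l)%:R * (a k * a l * b k)).
  by apply: eq_bigr => l _; rewrite hess0 mulrCA.
by rewrite sum_delta expr2.
Qed.

Let H0 : H z0 = A - 1.
Proof.
rewrite /H Y0 big1; last by move=> k _; rewrite y0 mulr0.
by rewrite mulr0 !addr0 !mulr1.
Qed.

Let DL : D i0 L z0 = \sum_k a k * t k.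
Proof.
rewrite /L (frame_sum y oU) //; last by move=> k; apply: smooth_funM.
apply: eq_bigr => k _; rewrite (frameM y oU i0 (sc (a k)) (sW i0 k) Uz0).
by rewrite frame_cst mul0r add0r (WC i0 k i0 Uz0).
Qed.

Let sL : smooth_fun U L.
Proof. by apply: smooth_fun_sum => k; apply: smooth_funM. Qed.

Let sB : smooth_fun U B.
Proof. by do 2!apply: smooth_fun_sum => ?; apply: smooth_funM. Qed.

Let sH : smooth_fun U H.
Proof.
have sLy : smooth_fun U (fun u => 1 + \sum_k a k * y k u).
  by apply: smooth_funD => //; apply: smooth_fun_sum => k; apply: smooth_funM.
apply: smooth_funD => //; apply: smooth_funM => //; apply: smooth_funM; first exact: smooth_funM.
by apply: smooth_funD => //; apply: smooth_funM.
Qed.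

Section Direction.
Variable j : 'I_n.
Local Notation J f r := (jet2 U y f z0 j r).
Let e : R := (j == i0)%:R.

Let jM (f g : 'rV[R]_n -> R^o) (r1 r2 r3 r1' r2' r3' : R) :
  J f (r1, r2, r3) -> J g (r1', r2', r3') ->
  J (fun u => f u * g u) (r1 * r1', r2 * r1' + r1 * r2', r3 * r1' + 2 * (r2 * r2') + r1 * r3').
Proof. exact: jet2M. Qed.
Let jD (f g : 'rV[R]_n -> R^o) (r1 r2 r3 r1' r2' r3' : R) :
  J f (r1, r2, r3) -> J g (r1', r2', r3') ->
  J (fun u => f u + g u) (r1 + r1', r2 + r2', r3 + r3').
Proof. exact: jet2D. Qed.
Let jc (c : R) : J (fun=> c) (c, 0, 0). Proof. exact: jet2_cst. Qed.

Let jy k : J (y k) (0, (j == k)%:R, 0).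
Proof. by have := jet2_coord oU sy uJ k j Uz0; rewrite y0. Qed.

Let jx k : J (x k) (x k z0, (j == k)%:R * b j, T j k).
Proof.
apply: jet2_eq (jet2P y z0 j (sx k)) _; rewrite (Dx j k Uz0) hess0.
rewrite (frame_ext y oU j (fun u => Dx j k (u := u)) Uz0).
by rewrite (WC j k j Uz0).
Qed.

Let js : J s (s z0, x j z0, b j).
Proof.
apply: jet2_eq (jet2P y z0 j ss) _; rewrite (Ds j Uz0).
rewrite (frame_ext y oU j (fun u => Ds j (u := u)) Uz0) (Dx j j Uz0) hess0.
by rewrite eqxx mul1r.
Qed.

Let jW0 : J (W i0 i0) (b i0, t j, q j).
Proof.
by apply: jet2_eq (jet2P y z0 j (sW i0 i0)) _; rewrite hess0 eqxx mul1r (WC4 i0 j Uz0).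
Qed.

Let jyy : J (fun u => y i0 u * y i0 u) (0, 0, 2 * e).
Proof.
apply: jet2_eq (jM (jy i0) (jy i0)) _; rewrite -/e.
have ee : e * e = e by rewrite /e; case: (j == i0); rewrite ?mulr1 ?mulr0.
by congr (_, _, _); rewrite ?ee; ring.
Qed.

Let jyyF (F : 'rV[R]_n -> R^o) : smooth_fun U F ->
  J (fun u => y i0 u * y i0 u * F u) (0, 0, 2 * e * F z0).
Proof.
move=> sF; apply: jet2_eq (jM jyy (jet2P y z0 j sF)) _.
by move: (D j F z0) (D j (D j F) z0) => p r; congr (_, _, _); ring.
Qed.

Let jyL : J (fun u => y i0 u * L u) (0, 0, 2 * (e * \sum_k a k * t k)).
Proof.
apply: jet2_eq (jM (jy i0) (jet2P y z0 j sL)) _; rewrite L0.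
have -> : e * (\sum_k a k * t k) = e * D j L z0.
  by rewrite -DL /e; case: eqP => [->//|_]; rewrite !mul0r.
by move: (D j L z0) (D j (D j L) z0) => p r; rewrite -/e; congr (_, _, _); ring.
Qed.

Let jf1 : J f1 (s z0 * b i0, x j z0 * b i0 + s z0 * t j,
  b j * b i0 + 2 * (x j z0 * t j) + s z0 * (q j + 4 * (e * \sum_k a k * t k)
     + 2 * e * \sum_k a k ^+ 2 * b k)).
Proof.
have j2 := jM (jc 2) jyL.
have jB := jyyF sB; rewrite B0 in jB.
apply: jet2_eq (jM js (jD jW0 (jD j2 jB))) _.
by congr (_, _, _); ring.
Qed.

Let jxy : J (fun u => \sum_i x i u * y i u) (0, x j z0, 2 * b j).
Proof.
apply: jet2_eq (jet2_sum oU sy uJ _ Uz0 (fun k => jM (jx k) (jy k))) _; congr (_, _, _).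
- by rewrite big1 // => k _; rewrite mulr0.
- transitivity (\sum_k (j == k)%:R * x k z0); last exact: sum_delta.
  by apply: eq_bigr => k _; rewrite mulr0 add0r mulrC.
transitivity (\sum_k (j == k)%:R * (2 * ((j == k)%:R * b j))); last by rewrite sum_delta eqxx mul1r.
by apply: eq_bigr => k _; ring.
Qed.

Let jxx : J (fun u => \sum_i x i u * x i u) (\sum_i x i z0 * x i z0, 2 * (x j z0 * b j),
  2 * (\sum_k x k z0 * T j k + b j ^+ 2)).
Proof.
apply: jet2_eq (jet2_sum oU sy uJ _ Uz0 (fun k => jM (jx k) (jx k))) _; congr (_, _, _).
- transitivity (\sum_k (j == k)%:R * (2 * (x k z0 * b j))); last exact: sum_delta.
  by apply: eq_bigr => k _; ring.
transitivity (\sum_k (2 * (x k z0 * T j k) + (j == k)%:R * (2 * ((j == k)%:R * b j ^+ 2)))).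
  by apply: eq_bigr => k _; ring.
by rewrite big_split /= sum_delta -mulr_sumr eqxx mul1r -mulrDr.
Qed.

(** The height is stationary at z0, because sum x_i y_i and [s] both have derivative x_j there. *)
Let jm : J m (- s z0, 0, b j).
Proof.
apply: jet2_eq (jD jxy (jM (jc (-1)) js)) _.
by congr (_, _, _); ring.
Qed.

Let jC : J C (s z0 * b i0, th * (x j z0 * b j),
  th * (\sum_k x k z0 * T j k + b j ^+ 2 - s z0 * b j)).
Proof.
have [_ /= mE _ _] := jm.
rewrite -maxW0; apply: jet2_eq (jD (jc C0) (jM (jc (th / 2)) (jD jxx (jM jm jm)))) _.
move: (\sum_k x k z0 * T j k) => S; rewrite /C mE.
by congr (_, _, _); field.
Qed.

Let jf2 : J f2 (s z0 * b i0, th * (x j z0 * b j),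
  th * (\sum_k x k z0 * T j k + b j ^+ 2 - s z0 * b j) + 2 * e * (s z0 * b i0 * (A - 1))).
Proof.
have jH := jyyF sH; rewrite H0 in jH.
apply: jet2_eq (jM jC (jD (jc 1) jH)) _.
by congr (_, _, _); ring.
Qed.

Lemma test_function_derivatives :
  x j z0 * b i0 + s z0 * t j = th * (x j z0 * b j) /\
  b j * b i0 + 2 * (x j z0 * t j) + s z0 * (q j + 4 * (e * \sum_k a k * t k)
     + 2 * e * \sum_k a k ^+ 2 * b k) <=
  th * (\sum_k x k z0 * T j k + b j ^+ 2 - s z0 * b j) + 2 * e * (s z0 * b i0 * (A - 1)).
Proof.
have [/= sPhi Phi0 D1 D2] := jD jf1 (jM (jc (-1)) jf2).
have Phimax u : U u -> Phi u <= Phi z0.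
  by move=> Uu; rewrite [leRHS](_ : _ = 0) ?Phi_le0 // /Phi Phi0 mulN1r subrr.
have [] := frame_at_max oU sy uJ j sPhi Uz0 Phimax.
rewrite D1 D2 !mul0r !mulr0 !add0r !mulN1r.
by move=> /eqP; rewrite subr_eq0 => /eqP -> le; split => //; rewrite -subr_le0.
Qed.
End Direction.

Lemma umbilic_of_max : (forall i, x i z0 = 0) /\ (forall i, b i = b i0).
Proof.
apply: (@umbilic_inequality R n i0 al th (s z0) b (fun i => x i z0) t q a (fun k l => D i0 (W k l) z0) T) => //.
- by rewrite /a eqxx.
- by move=> k /negPf ki; rewrite /a ki; field; rewrite gt_eqF.
- by move=> j; have [E _] := test_function_derivatives j; rewrite mulrBr [in RHS]mulrCA -E addrC addKr.
- by move=> j; rewrite (Wext i0 j i0 Uz0) (WC i0 j i0 Uz0).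
- by move=> j; rewrite (WC i0 j i0 Uz0).
- by move=> i; exact: monge_ampere_deriv1.
- exact: monge_ampere_deriv2.
move=> j; have [_] := test_function_derivatives j.
rewrite -subr_le0; congr (_ <= _).
rewrite sumrB big_split /= -/A.
have -> : \sum_k 4 * a k * t k = 4 * \sum_k a k * t k.
  by rewrite mulr_sumr; apply: eq_bigr => k _; rewrite mulrA.
have -> : \sum_k 2 * a k ^+ 2 * b k = 2 * \sum_k a k ^+ 2 * b k.
  by rewrite mulr_sumr; apply: eq_bigr => k _; rewrite mulrA.
rewrite -mulr_sumr -/A; move: (\sum_k a k * t k) (\sum_k a k ^+ 2 * b k) (\sum_k _) => p1 p2 p3.
ring.
Qed.

End TestFunction.

Lemma monge_ampere_umbilic (R : realType) (n : nat) (U : set 'rV[R]_n)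
    (y x : 'I_n -> 'rV[R]_n -> R^o) (s : 'rV[R]_n -> R^o) (W : 'rV[R]_n -> 'M[R]_n)
    (z0 : 'rV[R]_n) (al th C0 : R) (b : 'I_n -> R) (i0 : 'I_n) :
  open U -> U z0 -> (2 <= n)%N -> 0 < al -> 0 < th -> n%:R * al * th = n%:R * al - 1 ->
  (forall i, smooth_fun U (y i)) -> (forall u, U u -> jacobian_mx y u \in unitmx) ->
  (forall i, smooth_fun U (x i)) -> smooth_fun U s ->
  (forall i j, smooth_fun U (fun u => W u i j)) ->
  (forall i u, U u -> frame y i s u = x i u) ->
  (forall i j u, U u -> frame y i (x j) u = W u i j) ->
  (forall u, U u -> 0 < s u) -> (forall u, U u -> 0 < \det (W u)) ->
  (forall u, U u -> al * ln (\det (W u)) + ln (s u)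
     + ((n%:R + 2) * al - 1) / 2 * ln (1 + \sum_k y k u * y k u) = 0) ->
  (forall u, U u -> forall zeta : 'I_n -> R,
     s u * (\sum_k \sum_l zeta k * zeta l * W u k l) <=
     (C0 + th / 2 * (\sum_i x i u * x i u + (\sum_i x i u * y i u - s u) ^+ 2)) *
     (\sum_k zeta k ^+ 2 - (\sum_k zeta k * y k u) ^+ 2 * (1 - \sum_k y k u * y k u))) ->
  (forall i, y i z0 = 0) -> (forall i j, W z0 i j = (i == j)%:R * b i) ->
  (forall i, 0 < b i) -> (forall i, b i <= b i0) ->
  C0 + th / 2 * (\sum_i x i z0 * x i z0 + s z0 ^+ 2) = s z0 * b i0 ->
  (forall i, x i z0 = 0) /\ (forall i, b i = b i0).
Proof.
move=> oU Uz0 n2 al0 th0 Eth sy uJ sx ss sW Ds Dx s0 det0 pde maxW y0 W0 b0 bmax maxW0.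
have uW u : U u -> W u \in unitmx by move=> /det0 d0; rewrite unitmxE unitfE gt_eqF.
have sY := sqr_coord_smooth sy.
have mE u : \sum_i x i u * y i u + (-1) * s u = \sum_i x i u * y i u - s u by rewrite mulN1r.
apply: (@umbilic_of_max R n U y oU sy uJ z0 al b s (fun u => \sum_k y k u * y k u) x
  (fun i j u => W u i j) (fun i j u => invmx (W u) i j) Uz0 y0 ss sx sW _ sY _ _ _ _ _ _ _ _
  th C0 i0 n2 al0 th0 Eth) => //.
- exact: smooth_fun_invmx.
- by rewrite big1 // => k _; rewrite y0 mulr0.
- exact: sqr_coord1_gt0.
- move=> l k u Uu; transitivity ((W u *m invmx (W u)) l k); first by rewrite mxE.
  by rewrite mulmxV ?uW // mxE.
- move=> i u Uu; exact: (monge_ampere_deriv oU sy uJ ss s0 sW Ds det0 pde i Uu).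
- exact: s0.
- by move=> u Uu zeta; rewrite mE -expr2; exact: maxW.
rewrite mE -expr2 -maxW0; congr (_ + _ * (_ + _)).
by rewrite big1 ?sub0r ?sqrrN // => k _; rewrite y0 mulr0.
Qed.

(** * Local geometry of hypersurfaces *)

Section Dot.
Context {R : realType} {m : nat}.
Implicit Types v w : 'rV[R]_m.

Lemma dotE v w : dot v w = (v *m w^T) 0 0.
Proof. by rewrite mxE; apply: eq_bigr => k _; rewrite mxE. Qed.

Lemma dotC v w : dot v w = dot w v.
Proof. by apply: eq_bigr => k _; rewrite mulrC. Qed.

Lemma dotDl v1 v2 w : dot (v1 + v2) w = dot v1 w + dot v2 w.
Proof. by rewrite !dotE mulmxDl mxE. Qed.

Lemma dotZl (c : R) v w : dot (c *: v) w = c * dot v w.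
Proof. by rewrite !dotE -scalemxAl mxE. Qed.

Lemma dotNl v w : dot (- v) w = - dot v w.
Proof. by rewrite -scaleN1r dotZl mulN1r. Qed.

Lemma dot_suml (I : Type) (r : seq I) (F : I -> 'rV[R]_m) w :
  dot (\sum_(i <- r) F i) w = \sum_(i <- r) dot (F i) w.
Proof.
elim: r => [|i r IH]; last by rewrite !big_cons dotDl IH.
by rewrite !big_nil dotE mul0mx mxE.
Qed.

Lemma dot_gt0 v : v != 0 -> 0 < dot v v.
Proof.
move=> v0; rewrite lt_def; apply/andP; split; last by apply: sumr_ge0 => k _; rewrite -expr2 sqr_ge0.
apply: contra_neq v0 => /eqP; rewrite psumr_eq0; last by move=> k _; rewrite -expr2 sqr_ge0.
by move=> /allP v0; apply/rowP => k; have /eqP := v0 k (mem_index_enum _); move=> /eqP; rewrite mulf_eq0 orbb mxE => /eqP.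
Qed.

End Dot.

Section PartialDot.
Context {R : realType} {n m : nat}.
Implicit Types (X : 'rV[R]_n -> 'rV[R]_m) (N : 'rV[R]_m) (u : 'rV[R]_n).

Lemma partial_coord X j u k : differentiable X u ->
  partial j X u 0 k = partial j (fun v => X v 0 k : R^o) u.
Proof. by move=> dX; rewrite /partial derive_mx ?mxE //; apply: diff_derivable. Qed.

Lemma differentiable_entry X u k : differentiable X u -> differentiable (fun v => X v 0 k : R^o) u.
Proof.
move=> dX; apply: (@differentiable_comp _ _ _ _ X (fun M => M 0 k : R^o)) => //.
exact: differentiable_coord.
Qed.

Lemma differentiable_dot X N u : differentiable X u -> differentiable (fun v => dot (X v) N : R^o) u.
Proof.
move=> dX; have := @differentiable_sum R _ _ m (fun k v => X v 0 k * N 0 k : R^o) u.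
rewrite (_ : \sum_(k < m) _ = (fun v => dot (X v) N)); last by apply/funext => v; rewrite fct_sumE.
apply=> k; apply: differentiableM; first exact: differentiable_entry.
exact: differentiable_cst.
Qed.

Lemma partial_dot X N j u : differentiable X u ->
  partial j (fun v => dot (X v) N : R^o) u = dot (partial j X u) N.
Proof.
move=> dX; rewrite (partial_sum _ (F := fun k v => X v 0 k * N 0 k : R^o)); last first.
  move=> k; apply: differentiableM; first exact: differentiable_entry.
  exact: differentiable_cst.
apply: eq_bigr => k _; rewrite (partialM _ (f := fun v => X v 0 k : R^o) (g := fun=> N 0 k : R^o)).
- by rewrite partial_cst mulr0 addr0 partial_coord.
- exact: differentiable_entry.
- exact: differentiable_cst.
Qed.

Lemma partial_norm2 X j u : differentiable X u ->
  partial j (fun v => dot (X v) (X v) : R^o) u = 2 * dot (partial j X u) (X u).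
Proof.
move=> dX; have dXk k := differentiable_entry k dX.
rewrite (partial_sum _ j (F := fun k v => X v 0 k * X v 0 k : R^o)); last first.
  by move=> k; exact: differentiableM.
rewrite mulr_sumr; apply: eq_bigr => k _; rewrite (partialM j (dXk k) (dXk k)) -partial_coord //.
have E (p q : R) : p * q + q * p = 2 * (p * q) by ring.
exact: E.
Qed.

Lemma smooth_on_dot (U : set 'rV[R]_n) X N : open U -> smooth_on U X ->
  smooth_on U (fun u => dot (X u) N : R^o).
Proof.
move=> oU sX s; have E v : U v -> foldr partial (fun u => dot (X u) N : R^o) s v =
    dot (foldr partial X s v) N.
  elim: s v => [//|j s IH] v Uv /=.
  rewrite (partial_ext j oU Uv (g := fun u => dot (foldr partial X s u) N : R^o)) //.
  exact: partial_dot (sX s v Uv).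
move=> u Uu; apply: (differentiable_ext oU Uu (f := fun u => dot (foldr partial X s u) N : R^o)).
  by move=> v /E.
exact: differentiable_dot (sX s u Uu).
Qed.

Lemma partial_comp (V : normedModType R) (f : 'rV[R]_m -> V) (t : 'rV[R]_n -> 'rV[R]_m) j u :
  differentiable t u -> differentiable f (t u) ->
  partial j (f \o t) u = \sum_k (partial j t u) 0 k *: partial k f (t u).
Proof.
move=> dt df; rewrite /partial deriveE; last exact: differentiable_comp.
by rewrite diff_comp //= -(deriveE _ dt) -(deriveE _ df) derive_partial.
Qed.

End PartialDot.

Section ChartChange.
Context {R : realType} {n m : nat}.
Variables (O U : set 'rV[R]_n) (t : 'rV[R]_n -> 'rV[R]_n).
Hypotheses (oO : open O) (oU : open U) (tU : forall v, O v -> U (t v)).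
Hypothesis st : smooth_on O t.

(** At a critical point of [f] the Hessian transforms as a bilinear form: the second derivatives of
    the transition map [t] only occur multiplied by first derivatives of [f]. *)
Lemma partial2_comp (f : 'rV[R]_n -> R^o) i j v : smooth_on U f -> O v ->
  (forall k, partial k f (t v) = 0) ->
  partial i (partial j (f \o t)) v =
  \sum_k \sum_l (partial i t v) 0 l * (partial j t v) 0 k * partial l (partial k f) (t v).
Proof.
move=> sf Ov p0; have dt w : O w -> differentiable t w by exact: (st [::]).
have dpt w : O w -> differentiable (partial j t) w by exact: (st [:: j]).
have df w : O w -> differentiable f (t w) by move=> /tU; exact: (sf [::]).
have dpf k w : O w -> differentiable (partial k f) (t w) by move=> /tU; exact: (sf [:: k]).
rewrite (partial_ext i oO Ov (g := fun w => \sum_k (partial j t w) 0 k * partial k f (t w) : R^o)); last first.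
  by move=> w Ow; rewrite partial_comp //; [exact: dt | exact: df].
have d1 k : differentiable (fun w => partial j t w 0 k : R^o) v by apply: differentiable_entry; apply: dpt.
have d2 k : differentiable (partial k f \o t) v by apply: differentiable_comp; [exact: dt | exact: dpf].
rewrite (partial_sum _ (F := fun k w => (partial j t w) 0 k * partial k f (t w) : R^o)); last first.
  by move=> k; apply: differentiableM; [exact: d1 | exact: d2].
apply: eq_bigr => k _.
rewrite (partialM _ (f := fun w => (partial j t w) 0 k : R^o) (g := partial k f \o t)) //.
rewrite /= p0 mulr0 add0r (partial_comp i (dt v Ov) (dpf k v Ov)).
by rewrite mulr_sumr; apply: eq_bigr => l _; rewrite mulrCA mulrA.
Qed.

End ChartChange.

Lemma open_within_preimage (S T : topologicalType) (D : set S) (f : S -> T) (B : set T) :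
  open D -> {within D, continuous f} -> open B -> open (D `&` f @^-1` B).
Proof.
move=> oD cf oB; rewrite openE => x [Dx Bfx].
have nD : nbhs x D by exact: open_nbhs_nbhs.
have nB : nbhs (f x) B by exact: open_nbhs_nbhs.
have cx : {for x, continuous f}.
  by move: cf; rewrite continuous_open_subspace // => /(_ x); apply; rewrite inE.
exact: filterI nD (cx _ nB).
Qed.

Section LocalForms.
Context {R : realType} {n : nat}.
Variables (U : set 'rV[R]_n) (X : 'rV[R]_n -> 'rV[R]_n.+1).
Hypotheses (oU : open U) (sX : smooth_on U X).

(** With [N] a fixed vector this is the ordinary Hessian of <X, N>. The Christoffel terms of
    [second_form] are tangential and vanish against a normal [N]. *)
Definition normal_hessian (N : 'rV[R]_n.+1) u : 'M[R]_n :=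
  \matrix_(i, j) dot (partial i (partial j X) u) N.

Lemma first_form_sym u : (metric X u)^T = metric X u.
Proof. by apply/matrixP => i j; rewrite !mxE; exact: dotC. Qed.

Lemma normal_hessian_sym N u : U u -> (normal_hessian N u)^T = normal_hessian N u.
Proof.
move=> Uu; apply/matrixP => i j; rewrite !mxE.
have E k l : dot (partial k (partial l X) u) N =
    partial k (partial l (fun v => dot (X v) N : R^o)) u.
  rewrite (partial_ext k oU Uu (g := fun v => dot (partial l X v) N : R^o)).
    by rewrite partial_dot //; exact: (sX [:: l]).
  by move=> v Uv; rewrite partial_dot //; exact: (sX [::]).
apply: etrans (E j i) _; apply: etrans _ (esym (E i j)); apply: (partialC _ _ oU _ Uu).
by apply: smooth_fun_base; exact: smooth_on_dot.
Qed.

Lemma second_form_normal N u : (forall k, dot (partial k X u) N = 0) ->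
  second_form X N u = normal_hessian N u.
Proof.
move=> X0; apply/matrixP => i j; rewrite !mxE /cov_hessian dotDl dotNl dot_suml.
by rewrite big1 ?subr0 // => k _; rewrite dotZl X0 mulr0.
Qed.

Lemma metric_posdef u : U u -> injective ('d X u) -> posdef (metric X u).
Proof.
move=> Uu iX w w0.
have E : w *m metric X u *m w^T = (dot ('d X u w) ('d X u w))%:M.
  have dE : 'd X u w = \sum_i w 0 i *: partial i X u.
    by rewrite -deriveE ?derive_partial //; exact: (sX [::]).
  apply/matrixP => a c; rewrite !ord1 [RHS]mxE eqxx mulr1n mxE.
  rewrite {1}dE dot_suml; apply: eq_bigr => j _; rewrite !mxE dotZl mulrC; congr (_ * _).
  rewrite dotC dE dot_suml; apply: eq_bigr => i _; rewrite !mxE dotZl //.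
rewrite E mxE eqxx mulr1n dot_gt0 //; apply: contra_neq w0 => /eqP.
by rewrite -(linear0 ('d X u)) => /eqP /iX.
Qed.

End LocalForms.

(** * Curvature at nearby points, read in the single chart around p0 *)

Section ChartIndependence.
Context {R : realType} {n : nat} {M : topologicalType}.
Variables (A : smooth_structure R n M) (F nu : M -> 'rV[R]_n.+1).
Hypothesis hF : smooth_immersion A F.
Hypothesis nuT : forall p i, dot (partial i (in_chart A F p) (Defs.coord A p)) (nu p) = 0.
Hypothesis hconv : strictly_convex A F nu.
Variable p0 : M.

Local Notation U := (chart_cod (chart_at A p0)).
Local Notation X := (in_chart A F p0).
Local Notation inv0 := (chart_inv (chart_at A p0)).

Lemma coord_cod p : chart_cod (chart_at A p) (Defs.coord A p).
Proof. by apply: chart_map_cod; exact: chart_at_dom. Qed.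

Lemma coordK p : chart_inv (chart_at A p) (Defs.coord A p) = p.
Proof. by apply: chart_mapK; exact: chart_at_dom. Qed.

Lemma in_chart_coord (T : Type) (f : M -> T) p : in_chart A f p (Defs.coord A p) = f p.
Proof. by rewrite /in_chart /= coordK. Qed.

(** The geometry at q is defined in the chart chosen around q, while the maximum principle needs all
    nearby points in the chart around p0. [T] is the Jacobian matrix of the transition map at q; the
    second form transforms like the metric because <X, nu q> is critical at [u]. *)
Lemma chart_change u : U u ->
  exists T : 'M[R]_n, [/\ T \in unitmx,
    metric_at A F (inv0 u) = T *m metric X u *m T^T,
    second_form_at A F nu (inv0 u) = T *m normal_hessian X (nu (inv0 u)) u *m T^T &
    forall k, dot (partial k X u) (nu (inv0 u)) = 0].
Proof.
move=> Uu; set q := inv0 u; set v := Defs.coord A q.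
pose cq := chart_at A q; pose c0 := chart_at A p0.
pose O := chart_cod cq `&` chart_inv cq @^-1` chart_dom c0.
have oO : open O.
  apply: open_within_preimage; [exact: chart_cod_open | exact: chart_inv_continuous | exact: chart_dom_open].
have Ov : O v.
  by split; [exact: coord_cod | rewrite /= coordK; exact: chart_inv_dom].
pose t := chart_map c0 \o chart_inv cq.
have st : smooth_on O t by exact: chart_at_compat.
have tU w : O w -> U (t w) by move=> [_ /=]; exact: chart_map_cod.
have tv : t v = u by rewrite /t /= coordK chart_invK.
have XE w : O w -> in_chart A F q w = X (t w).
  by move=> [_ Ow]; rewrite /in_chart /= chart_mapK.
have sX : smooth_on U X := (hF p0).1.
have dt w : O w -> differentiable t w by exact: (st [::]).
have dX w : O w -> differentiable X (t w) by move=> /tU; exact: (sX [::]).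
have D1 i w : O w -> partial i (in_chart A F q) w = \sum_k partial i t w 0 k *: partial k X (t w).
  move=> Ow; rewrite -(partial_comp i (dt w Ow) (dX w Ow)).
  exact: (partial_ext i oO Ow).
pose T : 'M[R]_n := \matrix_(i, k) partial i t v 0 k.
have gT : metric_at A F q = T *m metric X u *m T^T.
  apply/matrixP => i j; rewrite [LHS]mxE -/v D1 // dot_suml mxE.
  under [RHS]eq_bigr do rewrite mxE mulr_suml.
  rewrite [RHS]exchange_big; apply: eq_bigr => k _ /=.
  rewrite dotZl dotC D1 // dot_suml mulr_sumr; apply: eq_bigr => l _.
  have gE : metric X u k l = dot (partial l X (t v)) (partial k X (t v)).
    by rewrite mxE tv; exact: dotC.
  rewrite dotZl gE [T^T l j]mxE [T j l]mxE [T i k]mxE mulrCA; exact: mulrC.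
have uT : T \in unitmx.
  have := posdef_unitmx (metric_posdef (hF q).1 (coord_cod q) ((hF q).2 _ (coord_cod q))).
  rewrite -/(metric_at A F q) gT !unitmxE !det_mulmx !unitrM => /andP[/andP[? _] _] //.
have nuX k : dot (partial k X u) (nu q) = 0.
  have : T *m (\col_k dot (partial k X u) (nu q)) = 0.
    apply/matrixP => i a; rewrite !mxE -[RHS](nuT q i) -/v D1 // dot_suml.
    by apply: eq_bigr => l _; rewrite dotZl !mxE tv.
  move=> /(congr1 (mulmx (invmx T))); rewrite mulKmx // mulmx0.
  by move=> /matrixP/(_ k 0); rewrite !mxE.
exists T; split=> //.
rewrite /second_form_at second_form_normal; last by move=> k; exact: nuT.
apply/matrixP => i j; rewrite mxE -/v.
pose f w : R^o := dot (X w) (nu q).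
have sf : smooth_on U f by apply: smooth_on_dot => //; exact: chart_cod_open.
have pf k w : U w -> partial k f w = dot (partial k X w) (nu q).
  by move=> Uw; rewrite partial_dot //; exact: (sX [::]).
transitivity (partial i (partial j (f \o t)) v).
  have dY w : O w -> differentiable (partial j (in_chart A F q)) w.
    by move=> [Ow _]; exact: ((hF q).1 [:: j]).
  rewrite -(partial_dot _ _ (dY v Ov)); apply: (partial_ext i oO Ov) => w Ow.
  rewrite -partial_dot; last by case: Ow => Ow _; exact: ((hF q).1 [::]).
  by apply: (partial_ext j oO Ow) => z Oz; rewrite /f /= XE.
rewrite (partial2_comp oO tU st _ _ sf Ov); last by move=> k; rewrite pf ?tv //; exact: nuX.
rewrite mxE; apply: eq_bigr => k _; rewrite mxE mulr_suml; apply: eq_bigr => l _.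
rewrite !mxE tv [RHS]mulrAC; congr (_ * _).
have oU : open U by exact: chart_cod_open.
rewrite (partial_ext l oU Uu (pf k)); apply: partial_dot; exact: (sX [:: k]).
Qed.

(** [T] cancels from det h / det g, and also from the inverse forms once the test vector is taken to
    be [w *m T^T]. *)
Lemma curvature_at u : (0 < n)%N -> U u ->
  let q := inv0 u in let g := metric X u in let h := normal_hessian X (nu q) u in
  [/\ forall k, dot (partial k X u) (nu q) = 0,
    posdef g /\ posdef h,
    gauss_curvature A F nu q = \det h / \det g /\ 0 < gauss_curvature A F nu q,
    0 < lambda_min A F nu q &
    forall w : 'rV_n, lambda_min A F nu q * (w *m invmx h *m w^T) 0 0 <= (w *m invmx g *m w^T) 0 0].
Proof.
move=> n0 Uu q g h; have [T [uT gT hT nuX]] := chart_change Uu.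
have oU : open U by exact: chart_cod_open.
have sX : smooth_on U X := (hF p0).1.
have gpos : posdef g := metric_posdef sX Uu ((hF p0).2 u Uu).
have hs : h^T = h by exact: normal_hessian_sym oU sX _ _ Uu.
have gs : g^T = g by exact: first_form_sym.
have fT : row_free T by rewrite row_free_unit.
have fV : row_free (invmx T) by rewrite row_free_unit unitmx_inv.
have hqpos : posdef (second_form_at A F nu q) by exact: hconv.
have hpos : posdef h.
  have := posdef_congr fV hqpos; rewrite hT -/h !mulmxA mulVmx // mul1mx -mulmxA -trmx_mul.
  by rewrite mulVmx // trmx1 mulmx1.
have congr_sym (B : 'M[R]_n) : B^T = B -> (T *m B *m T^T)^T = T *m B *m T^T.
  by move=> BT; rewrite !trmx_mul trmxK BT mulmxA.
have gqs : (metric_at A F q)^T = metric_at A F q by rewrite gT congr_sym.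
have hqs : (second_form_at A F nu q)^T = second_form_at A F nu q by rewrite hT congr_sym.
have gqpos : posdef (metric_at A F q) by rewrite gT; exact: posdef_congr.
have [Ek k0 l0 _ lw] := spectrum_min n0 gqs hqs gqpos hqpos.
have inv_congr (B : 'M[R]_n) : posdef B -> T^T *m invmx (T *m B *m T^T) *m T = invmx B.
  move=> /posdef_unitmx uB.
  have uTT : T^T \in unitmx by rewrite unitmx_tr.
  have E : invmx (T *m B *m T^T) = invmx T^T *m invmx B *m invmx T.
    apply: (can_inj (mulKmx (_ : T *m B *m T^T \in unitmx))).
      by rewrite !unitmx_mul uT uB.
    by rewrite mulmxV ?unitmx_mul ?uT ?uB // !mulmxA mulmxK // mulmxK // mulmxV.
  by rewrite E !mulmxA mulmxV // mul1mx mulmxKV.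
have T0 : \det T != 0 by rewrite -unitfE -unitmxE.
have g0 : \det g != 0 by rewrite -unitfE -unitmxE posdef_unitmx.
split; [exact: nuX | by split | split; last exact: k0 | exact: l0 |].
  apply: etrans Ek _; rewrite gT hT !det_mulmx det_tr -/h -/g.
  by field; rewrite g0 T0.
move=> w.
have E (B : 'M[R]_n) : posdef B ->
    w *m T^T *m invmx (T *m B *m T^T) *m (w *m T^T)^T = w *m invmx B *m w^T.
  by move=> /inv_congr <-; rewrite trmx_mul trmxK !mulmxA.
have lq : lambda_min A F nu q *
    (w *m T^T *m invmx (second_form_at A F nu q) *m (w *m T^T)^T) 0 0 <=
    (w *m T^T *m invmx (metric_at A F q) *m (w *m T^T)^T) 0 0 := lw _.
by move: lq; move: (lambda_min A F nu q) => l; rewrite gT hT (E _ gpos) (E _ hpos).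
Qed.

End ChartIndependence.

(** * Orthonormal bases and rank-one perturbations of the identity *)

Lemma parseval (R : realType) (n : nat) (E : 'I_n -> 'rV[R]_n.+1) (N : 'rV[R]_n.+1) :
  (forall i j, dot (E i) (E j) = (i == j)%:R) -> (forall i, dot (E i) N = 0) ->
  dot N N = 1 ->
  forall v w, dot v w = \sum_i dot v (E i) * dot w (E i) + dot v N * dot w N.
Proof.
move=> EE EN NN v w.
pose B : 'M[R]_(1 + n, n.+1) := col_mx N (\matrix_i E i).
have BB : B *m B^T = 1%:M.
  rewrite /B tr_col_mx mul_col_row scalar_mx_block; congr block_mx.
  - by apply/matrixP => i j; rewrite !ord1 -dotE NN !mxE.
  - apply/matrixP => i j; rewrite ord1 [RHS]mxE -(EN j) dotC dotE !mxE.
    by apply: eq_bigr => k _; rewrite !mxE.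
  - apply/matrixP => i j; rewrite ord1 [RHS]mxE -(EN i) dotE !mxE.
    by apply: eq_bigr => k _; rewrite !mxE.
  - apply/matrixP => i j; rewrite [RHS]mxE -EE mxE.
    by apply: eq_bigr => k _; rewrite !mxE.
have BB' : B^T *m B = 1%:M by exact: mulmx1C BB.
have -> : dot v w = ((v *m B^T) *m (w *m B^T)^T) 0 0.
  by rewrite trmx_mul trmxK !mulmxA -(mulmxA v) BB' mulmx1 -dotE.
have vB (z : 'rV[R]_n.+1) : z *m B^T = row_mx (dot z N)%:M (\row_i dot z (E i)).
  rewrite /B tr_col_mx mul_mx_row; congr row_mx.
    by apply/matrixP => i j; rewrite !ord1 -dotE !mxE.
  apply/matrixP => i j; rewrite ord1 [RHS]mxE dotE !mxE.
  by apply: eq_bigr => k _; rewrite !mxE.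
rewrite !vB tr_row_mx mul_row_col mxE addrC; congr (_ + _).
  by rewrite mxE; apply: eq_bigr => k _; rewrite !mxE.
by rewrite tr_scalar_mx -scalar_mxM !mxE.
Qed.

(** Two factorizations of one block matrix into block triangular ones have the same determinant
    (Sylvester's identity). *)
Lemma det_add_rank1 (R : realType) (n : nat) (y : 'rV[R]_n) :
  \det (1%:M + y^T *m y) = 1 + (y *m y^T) 0 0.
Proof.
have E1 : block_mx 1%:M (- y) y^T 1%:M =
    block_mx 1%:M 0 y^T 1%:M *m block_mx 1%:M (- y) 0 (1%:M + y^T *m y) :> 'M[R]_(1 + n).
  by rewrite mulmx_block !(mul1mx, mul0mx, mulmx0, mulmx1, addr0) mulmxN [_ + (1%:M + _)]addrC addrK.
have E2 : block_mx 1%:M (- y) y^T 1%:M =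
    block_mx 1%:M (- y) 0 1%:M *m block_mx (1%:M + y *m y^T) 0 y^T 1%:M :> 'M[R]_(1 + n).
  by rewrite mulmx_block !(mul1mx, mul0mx, mulmx0, mulmx1, add0r) mulNmx addrK.
have := congr1 determinant (etrans (esym E1) E2).
rewrite !det_mulmx !det_lblock !det_ublock !det1 !mul1r !mulr1 => ->.
by rewrite [X in \det X]mx11_scalar det_scalar1 !mxE.
Qed.

(** The Sherman-Morrison formula provides the explicit inverse [B]. *)
Lemma invmx_add_rank1 (R : realType) (n : nat) (y z : 'rV[R]_n) :
  (z *m invmx (1%:M + y^T *m y) *m z^T) 0 0 =
  dot z z - dot z y ^+ 2 / (1 + dot y y).
Proof.
have Y0 : 0 <= dot y y by apply: sumr_ge0 => k _; rewrite -expr2 sqr_ge0.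
have Y1 : 1 + dot y y != 0 by rewrite gt_eqF // ltr_wpDr.
pose B := 1%:M - (1 + dot y y)^-1 *: (y^T *m y).
have yy : y^T *m y *m (y^T *m y) = dot y y *: (y^T *m y).
  by rewrite mulmxA -(mulmxA y^T) [y *m y^T]mx11_scalar -dotE mul_mx_scalar -scalemxAl.
have AB : (1%:M + y^T *m y) *m B = 1%:M.
  rewrite /B mulmxBr mulmx1 -scalemxAr mulmxDl mul1mx yy scalerDr scalerA -scalerDl.
  by rewrite -{1}[(1 + dot y y)^-1]mulr1 -mulrDr mulVf // scale1r addrK.
have [u1 _] := mulmx1_unit AB.
have -> : invmx (1%:M + y^T *m y) = B by apply: (can_inj (mulKmx u1)); rewrite mulmxV ?AB.
rewrite /B mulmxBr mulmxBl mulmx1 -scalemxAr -scalemxAl.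
have subE (C1 C2 : 'M[R]_1) (c : R) : (C1 - c *: C2) 0 0 = C1 0 0 - c * C2 0 0 by rewrite !mxE.
rewrite subE -dotE mulrC; congr (_ - _ / _).
by rewrite (mulmxA z) -(mulmxA (z *m y^T)) mxE big_ord1 -!dotE (dotC y z) expr2.
Qed.

Lemma open_smooth_gt0 (R : realType) (n : nat) (U : set 'rV[R]_n) (f : 'rV[R]_n -> R^o) :
  open U -> smooth_fun U f -> open (U `&` [set u | 0 < f u]).
Proof.
move=> oU sf; rewrite openE => u [Uu /= fu].
have cf : {for u, continuous f} by apply: differentiable_continuous; exact: smooth_fun_diff sf Uu.
apply: filterI; first exact: open_nbhs_nbhs.
have H : nbhs (f u) [set r : R^o | 0 < r].
  by apply: open_nbhs_nbhs; split => //; exact: (@open_gt R 0).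
exact: (cf _ H).
Qed.

(** * The graph over the tangent plane and its Legendre transform *)

Section AdaptedFrame.
Context {R : realType} {n : nat}.
Variables (U0 : set 'rV[R]_n) (X : 'rV[R]_n -> 'rV[R]_n.+1).
Hypotheses (oU0 : open U0) (sX : smooth_on U0 X).
Variables (E : 'I_n -> 'rV[R]_n.+1) (N0 : 'rV[R]_n.+1).
Hypothesis EE : forall i j, dot (E i) (E j) = (i == j)%:R.
Hypothesis EN : forall i, dot (E i) N0 = 0.
Hypothesis NN : dot N0 N0 = 1.

Definition tangential i u : R^o := dot (X u) (E i).
Definition height u : R^o := dot (X u) N0.

(* (- slope, 1) is normal to the graph of height over the tangential coordinates *)
Definition slope i : 'rV[R]_n -> R^o := frame tangential i height.

(* the Legendre transform of height *)
Definition support_fun u : R^o := \sum_i tangential i u * slope i u - height u.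

Local Notation x := tangential.
Local Notation y := slope.
Local Notation Jx := (jacobian_mx x).
Local Notation Jy := (jacobian_mx y).

(** The square expresses that the determinant does not vanish as positivity of a smooth function,
    from which openness follows. *)
Definition graph_dom := U0 `&` [set u | 0 < \det (Jx u) ^+ 2].
Local Notation U1 := graph_dom.

Lemma tangential_smooth i : smooth_fun U0 (x i).
Proof. by apply: smooth_fun_base; exact: smooth_on_dot. Qed.

Lemma height_smooth : smooth_fun U0 height.
Proof. by apply: smooth_fun_base; exact: smooth_on_dot. Qed.

Lemma graph_dom_open : open U1.
Proof.
apply: (open_smooth_gt0 oU0); rewrite /GRing.exp /=.
have sd : smooth_fun U0 (fun u => \det (Jx u)).
  apply: smooth_fun_det => k i.
  by apply: smooth_fun_ext (smooth_fun_partial k oU0 (tangential_smooth i)) _ => u _; rewrite mxE.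
exact: (smooth_funM sd sd).
Qed.

Lemma graph_dom_unitmx u : U1 u -> Jx u \in unitmx.
Proof.
move=> [_ /= d0]; rewrite unitmxE unitfE; apply: contraTneq d0 => ->.
by rewrite expr0n ltxx.
Qed.

Lemma sub_graph_dom : U1 `<=` U0. Proof. by move=> u []. Qed.

Let oU1 := graph_dom_open.

Let sx i : smooth_fun U1 (x i).
Proof. exact: smooth_funW sub_graph_dom (tangential_smooth i). Qed.

Lemma slope_smooth i : smooth_fun U1 (y i).
Proof.
apply: (frame_smooth oU1 sx graph_dom_unitmx).
exact: smooth_funW sub_graph_dom height_smooth.
Qed.

Lemma support_smooth : smooth_fun U1 support_fun.
Proof.
apply: smooth_funB; last exact: smooth_funW sub_graph_dom height_smooth.
apply: smooth_fun_sum => i; apply: smooth_funM; [exact: sx | exact: slope_smooth].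
Qed.

Lemma partial_height k u : U1 u ->
  partial k height u = \sum_i y i u * partial k (x i) u.
Proof.
move=> Uu; transitivity ((Jx u *m \col_i y i u) k 0); last first.
  by rewrite mxE; apply: eq_bigr => i _; rewrite !mxE mulrC.
have -> : \col_i y i u = invmx (Jx u) *m \col_k partial k height u.
  by apply/matrixP => i j; rewrite !mxE; apply: eq_bigr => l _; rewrite !mxE.
by rewrite mulKVmx ?graph_dom_unitmx // mxE.
Qed.

(** Legendre duality: as the differential of the height is sum y_i dx_i by [partial_height], that of
    [support_fun] is sum x_i dy_i. *)
Lemma frame_support i u : U1 u -> Jy u \in unitmx -> frame y i support_fun u = x i u.
Proof.
move=> Uu uJy; have dx j : differentiable (x j) u by exact: smooth_fun_diff oU1 (sx j) Uu.
have dy j : differentiable (y j) u by exact: smooth_fun_diff oU1 (slope_smooth j) Uu.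
have dh : differentiable height u by exact: smooth_fun_diff oU0 height_smooth (sub_graph_dom Uu).
have pS k : partial k support_fun u = \sum_j partial k (y j) u * x j u.
  have dxy j : differentiable (fun v => x j v * y j v : R^o) u by exact: differentiableM.
  have sxy : smooth_fun U1 (fun v => \sum_j x j v * y j v).
    by apply: smooth_fun_sum => j; apply: smooth_funM; [exact: sx | exact: slope_smooth].
  have sh : smooth_fun U1 (fun v => -1 * height v).
    by apply: smooth_funM; [exact: smooth_fun_cst | exact: smooth_funW sub_graph_dom height_smooth].
  transitivity (partial k (fun v => (\sum_j x j v * y j v) + (-1) * height v : R^o) u).
    by apply: (congr1 (fun f => partial k f u)); apply/funext => v; rewrite [-1 * _]mulN1r.
  rewrite (partialD k (smooth_fun_diff oU1 sxy Uu) (smooth_fun_diff oU1 sh Uu)).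
  rewrite (partialM k (f := fun=> -1 : R^o) _ dh); last exact: differentiable_cst.
  rewrite partial_cst mul0r add0r mulN1r partial_height // (partial_sum _ k dxy) -sumrB.
  apply: eq_bigr => j _; rewrite (partialM k (dx j) (dy j)).
  have ringE (p q r t : R) : p * q + r * t - q * p = t * r by ring.
  exact: ringE.
transitivity ((invmx (Jy u) *m (Jy u *m \col_j x j u)) i 0); last by rewrite mulKmx // mxE.
rewrite mxE; apply: eq_bigr => k _; congr (_ * _); rewrite pS mxE.
by apply: eq_bigr => j _; rewrite !mxE.
Qed.

(** Since x is the gradient of [support_fun] in the coordinates y, this matrix is the Hessian W. *)
Lemma frame_tangential i j u : frame y i (x j) u = (invmx (Jy u) *m Jx u) i j.
Proof. by rewrite mxE; apply: eq_bigr => k _; rewrite [in RHS]mxE. Qed.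

Let dX u : U0 u -> differentiable X u. Proof. exact: (sX [::]). Qed.

Lemma partial_tangential k i u : U0 u -> partial k (x i) u = dot (partial k X u) (E i).
Proof. by move=> Uu; apply: partial_dot; exact: dX. Qed.

Lemma partial_heightE k u : U0 u -> partial k height u = dot (partial k X u) N0.
Proof. by move=> Uu; apply: partial_dot; exact: dX. Qed.

Let yv u : 'rV[R]_n := \row_i y i u.

(** In the coordinates x the metric of a graph is 1 + y^T y. *)
Lemma metric_graph u : U1 u ->
  metric X u = Jx u *m (1%:M + (yv u)^T *m yv u) *m (Jx u)^T.
Proof.
move=> Uu; have U0u := sub_graph_dom Uu.
have Jy_ k a : (Jx u *m (yv u)^T) k a = partial k height u.
  by rewrite partial_height // mxE; apply: eq_bigr => i _; rewrite !mxE mulrC.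
rewrite mulmxDr mulmx1 mulmxDl; apply/matrixP => k l; rewrite !mxE (parseval EE EN NN).
congr (_ + _).
  by apply: eq_bigr => i _; rewrite !mxE !partial_tangential.
transitivity (partial k height u * partial l height u).
  by congr (_ * _); apply/esym/partial_heightE.
transitivity ((Jx u *m (yv u)^T *m (Jx u *m (yv u)^T)^T) k l).
  by rewrite mxE big_ord1 [_^T ord0 l]mxE !Jy_.
by rewrite trmx_mul trmxK !mulmxA mxE.
Qed.

Section NormalVector.
Variables (N : 'rV[R]_n.+1) (u : 'rV[R]_n).
Hypotheses (Uu : U1 u) (XN : forall k, dot (partial k X u) N = 0).
Let c := dot N N0.

(** The normal line is spanned by N0 - sum y_i E_i, and [c] is the factor; its sign is still open
    here. *)
Lemma dot_normal v : dot v N = c * (dot v N0 - \sum_i y i u * dot v (E i)).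
Proof.
have U0u := sub_graph_dom Uu.
have NE i : dot N (E i) = - (c * y i u).
  have : Jx u *m \col_i (dot N (E i) + c * y i u) = 0.
    apply/matrixP => k a; rewrite !mxE -[RHS](XN k) (parseval EE EN NN) -partial_heightE //.
    rewrite partial_height // mulr_suml -big_split; apply: eq_bigr => l _ /=.
    by rewrite !mxE -partial_tangential // mulrDr -/c; congr (_ + _); ring.
  move=> /(congr1 (mulmx (invmx (Jx u)))); rewrite mulKmx ?graph_dom_unitmx // mulmx0.
  by move=> /matrixP/(_ i 0); rewrite !mxE => /eqP; rewrite addr_eq0 => /eqP.
rewrite (parseval EE EN NN) -/c.
have -> : \sum_i dot v (E i) * dot N (E i) = c * - \sum_i y i u * dot v (E i).
  by rewrite -sumrN [RHS]mulr_sumr; apply: eq_bigr => i _; rewrite NE; ring.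
by rewrite mulrBr mulrN addrC (mulrC _ c).
Qed.

(** When the formula for [partial_height] is differentiated, the terms with second derivatives of
    the x_k are those subtracted in [dot_normal]. What remains is c times the Hessian of the height
    with respect to x, pulled back to the chart. *)
Lemma normal_hessian_graph : normal_hessian X N u = c *: (Jy u *m (Jx u)^T).
Proof.
have U0u := sub_graph_dom Uu; apply/matrixP => i j; rewrite !mxE dot_normal; congr (_ * _).
have dpX : differentiable (partial j X) u by exact: (sX [:: j]).
have p2 V : dot (partial i (partial j X) u) V = partial i (partial j (fun v => dot (X v) V : R^o)) u.
  rewrite -(partial_dot _ _ dpX); apply: (partial_ext i oU0 U0u) => v U0v.
  by rewrite partial_dot //; exact: dX.
apply/eqP; rewrite subr_eq; apply/eqP; apply: etrans (p2 N0) _.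
have dy k : differentiable (y k) u by exact: smooth_fun_diff oU1 (slope_smooth k) Uu.
have dpx k : differentiable (partial j (x k)) u.
  exact: smooth_fun_diff oU1 (smooth_fun_partial j oU1 (sx k)) Uu.
have E1 : partial i (partial j height) u =
    partial i (fun v => \sum_k y k v * partial j (x k) v : R^o) u.
  by apply: (partial_ext i oU1 Uu) => v; exact: partial_height.
apply: etrans E1 _.
rewrite (partial_sum _ i (F := fun k v => y k v * partial j (x k) v : R^o)); last first.
  by move=> k; exact: differentiableM.
rewrite -big_split; apply: eq_bigr => k _ /=; rewrite (partialM i (dy k) (dpx k)) !mxE.
by congr (_ + _ * _); rewrite p2.
Qed.

(** Hence |c| = 1 / rho, with rho^2 = 1 + |y|^2. *)
Lemma normal_norm : dot N N = 1 -> c ^+ 2 * (1 + \sum_i y i u * y i u) = 1.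
Proof.
have NE i : dot N (E i) = - (c * y i u).
  rewrite dotC dot_normal EN (bigD1 i) //= EE eqxx mulr1 big1 ?addr0; first by ring.
  by move=> j ji; rewrite EE eq_sym (negPf ji) mulr0.
move=> NN1; rewrite -[RHS]NN1 (parseval EE EN NN) -/c mulrDr mulr1 addrC; congr (_ + _).
by rewrite mulr_sumr; apply: eq_bigr => i _; rewrite NE; ring.
Qed.

Lemma dot_support : dot (X u) N = - (c * support_fun u).
Proof.
rewrite dot_normal -mulrN /support_fun opprB; congr (_ * (_ - _)).
by apply: eq_bigr => i _; rewrite mulrC.
Qed.

End NormalVector.

Lemma norm_graph u : dot (X u) (X u) =
  \sum_i x i u * x i u + (\sum_i x i u * y i u - support_fun u) ^+ 2.
Proof. by rewrite (parseval EE EN NN) expr2 /support_fun opprB addrC addrCA subrr addr0 addrC. Qed.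

End AdaptedFrame.

(** * The theorem in one chart *)

Section LocalTheorem.
Context {R : realType} {n : nat}.
Variables (U0 : set 'rV[R]_n) (X N : 'rV[R]_n -> 'rV[R]_n.+1) (K l : 'rV[R]_n -> R).
Variables (al th : R) (z0 : 'rV[R]_n).
Hypotheses (oU0 : open U0) (sX : smooth_on U0 X) (U0z0 : U0 z0).
Hypotheses (n2 : (2 <= n)%N) (al0 : 0 < al) (th0 : 0 < th).
Hypothesis Eth : n%:R * al * th = n%:R * al - 1.
Hypothesis XN : forall u, U0 u -> forall k, dot (partial k X u) (N u) = 0.
Hypothesis NN : forall u, U0 u -> dot (N u) (N u) = 1.
Hypothesis gpos : forall u, U0 u -> posdef (metric X u).
Hypothesis hpos : forall u, U0 u -> posdef (normal_hessian X (N u) u).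
Hypothesis KE : forall u, U0 u -> K u = \det (normal_hessian X (N u) u) / \det (metric X u).
Hypothesis K0 : forall u, U0 u -> 0 < K u.
Hypothesis l0 : forall u, U0 u -> 0 < l u.
Hypothesis lw : forall u, U0 u -> forall w : 'rV_n,
  l u * (w *m invmx (normal_hessian X (N u) u) *m w^T) 0 0 <= (w *m invmx (metric X u) *m w^T) 0 0.
Hypothesis soliton : forall u, U0 u -> K u `^ al = - dot (X u) (N u).
Hypothesis wmax : forall u, U0 u ->
  K u `^ al * (l u)^-1 - th / 2 * dot (X u) (X u) <=
  K z0 `^ al * (l z0)^-1 - th / 2 * dot (X z0) (X z0).
Variables (P : 'M[R]_n) (d : 'rV[R]_n) (i0 : 'I_n).
Hypothesis Pg : P *m metric X z0 *m P^T = 1%:M.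
Hypothesis Ph : P *m normal_hessian X (N z0) z0 *m P^T = diag_mx d.
Hypotheses (di0 : d 0 i0 = l z0) (dmin : forall i, d 0 i0 <= d 0 i).

Let E i : 'rV[R]_n.+1 := \sum_k P i k *: partial k X z0.
Let N0 := N z0.

Let EE i j : dot (E i) (E j) = (i == j)%:R.
Proof.
transitivity ((P *m metric X z0 *m P^T) i j); last by rewrite Pg mxE.
rewrite dot_suml mxE; under [RHS]eq_bigr do rewrite mxE mulr_suml.
rewrite [RHS]exchange_big; apply: eq_bigr => k _ /=.
rewrite dotZl dotC dot_suml mulr_sumr; apply: eq_bigr => m _.
have gkm : metric X z0 k m = dot (partial m X z0) (partial k X z0) by rewrite mxE; exact: dotC.
by rewrite dotZl gkm [P^T m j]mxE mulrCA mulrC.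
Qed.

Let EN i : dot (E i) N0 = 0.
Proof. by rewrite dot_suml big1 // => k _; rewrite dotZl XN // mulr0. Qed.

Let N01 : dot N0 N0 = 1. Proof. exact: NN. Qed.

Local Notation x := (tangential X E).
Local Notation y := (slope X E N0).
Local Notation s := (support_fun X E N0).
Local Notation Jx := (jacobian_mx x).
Local Notation Jy := (jacobian_mx y).
Local Notation U1 := (graph_dom U0 X E).

Let oU1 : open U1. Proof. exact: graph_dom_open. Qed.

Let Jx0 : P *m Jx z0 = 1%:M.
Proof.
have JE : Jx z0 = metric X z0 *m P^T.
  apply/matrixP => k i; rewrite mxE (partial_tangential sX E k i U0z0) [RHS]mxE dotC dot_suml.
  apply: eq_bigr => m _; rewrite dotZl [P^T m i]mxE mulrC; congr (_ * _).
  by rewrite mxE; exact: dotC.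
by rewrite JE mulmxA.
Qed.

Let c u := dot (N u) N0.
Let H u := Jy u *m (Jx u)^T.

Let hE u : U1 u -> normal_hessian X (N u) u = c u *: H u.
Proof. by move=> Uu; apply: (normal_hessian_graph oU0 sX EE EN N01 Uu); exact: XN (sub_graph_dom Uu). Qed.

(* where H i0 i0 > 0 the normal N u points to the same side as N0 *)
Let U2 := U1 `&` [set u | 0 < H u i0 i0].

Let sy i : smooth_fun U1 (y i). Proof. exact: slope_smooth. Qed.
Let sx i : smooth_fun U1 (x i).
Proof. exact: smooth_funW (@sub_graph_dom _ _ U0 X E) (tangential_smooth oU0 sX E i). Qed.

Let sJx i k : smooth_fun U1 (fun u => Jx u i k).
Proof. by apply: smooth_fun_ext (smooth_fun_partial i oU1 (sx k)) _ => u _; rewrite mxE. Qed.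

Let sJy i k : smooth_fun U1 (fun u => Jy u i k).
Proof. by apply: smooth_fun_ext (smooth_fun_partial i oU1 (sy k)) _ => u _; rewrite mxE. Qed.

Let oU2 : open U2.
Proof.
apply: (open_smooth_gt0 oU1 (f := fun u => H u i0 i0)).
have sS : smooth_fun U1 (fun u => \sum_k Jy u i0 k * Jx u i0 k).
  by apply: smooth_fun_sum => k; apply: smooth_funM; [exact: sJy | exact: sJx].
by apply: smooth_fun_ext sS _ => u _; rewrite [RHS]mxE; apply: eq_bigr => k _; congr (_ * _); rewrite [RHS]mxE.
Qed.

Let sub21 u : U2 u -> U1 u. Proof. by case. Qed.
Let sub20 u : U2 u -> U0 u. Proof. by case=> -[]. Qed.

Let posdef_diag (B : 'M[R]_n) i : posdef B -> 0 < B i i.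
Proof.
move=> Bpos; have e0 : delta_mx (0 : 'I_1) i != 0 :> 'rV[R]_n.
  by apply/eqP => /matrixP/(_ 0 i); rewrite !mxE !eqxx => /eqP; rewrite oner_eq0.
by have := Bpos _ e0; rewrite trmx_delta -rowE -colE !mxE.
Qed.

(** [N] is given pointwise, without continuity. Convexity decides its side: c H_{i0 i0} is a
    diagonal entry of a positive definite form. *)
Let c_gt0 u : U2 u -> 0 < c u.
Proof.
move=> U2u; have [_ /= H0] := U2u.
have := posdef_diag i0 (hpos (sub20 U2u)); rewrite (hE (sub21 U2u)) mxE.
by rewrite pmulr_lgt0.
Qed.

Local Notation Y u := (\sum_k y k u * y k u).

Let cY u : U2 u -> c u ^+ 2 * (1 + Y u) = 1.
Proof.
move=> Uu; apply: (normal_norm sX EE EN N01 (sub21 Uu)); last exact: NN (sub20 Uu).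
exact: XN (sub20 Uu).
Qed.

Let uJx u : U2 u -> Jx u \in unitmx.
Proof. by move=> /sub21; exact: graph_dom_unitmx. Qed.

Let uJy u : U2 u -> Jy u \in unitmx.
Proof.
move=> Uu; have := posdef_unitmx (hpos (sub20 Uu)); rewrite (hE (sub21 Uu)).
by rewrite unitmxZ ?unitfE ?gt_eqF ?c_gt0 // unitmx_mul => /andP[].
Qed.

Let gE u : U1 u -> metric X u = Jx u *m (1%:M + (\row_i y i u)^T *m \row_i y i u) *m (Jx u)^T.
Proof. exact: (metric_graph sX EE EN N01). Qed.

Let W u := invmx (Jy u) *m Jx u.

Let rowY u : dot (\row_i y i u) (\row_i y i u) = Y u.
Proof. by apply: eq_bigr => i _; rewrite !mxE. Qed.

(** In det h / det g the factors are h = c H and det g = det(Jx)^2 (1 + |y|^2); with c = 1 / rho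
    this is c^(n+2) / det W. *)
Let detW u : U2 u -> \det (W u) = c u ^+ n.+2 / K u.
Proof.
move=> Uu; have c0 := c_gt0 Uu; have Y1 := cY Uu.
have Jx0' : \det (Jx u) != 0 by rewrite -unitfE -unitmxE uJx.
have Jy0' : \det (Jy u) != 0 by rewrite -unitfE -unitmxE uJy.
have c2 : c u != 0 by rewrite gt_eqF.
have Y2 : 1 + Y u = (c u ^+ 2)^-1 by apply: (mulfI (expf_neq0 2 c2)); rewrite Y1 mulfV // expf_neq0.
rewrite (KE (sub20 Uu)) (hE (sub21 Uu)) (gE (sub21 Uu)) /W /H detZ !det_mulmx !det_tr det_inv.
rewrite det_add_rank1 -dotE rowY Y2 -(addn2 n) exprD.
by field; rewrite Jx0' Jy0' c2 expf_neq0.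
Qed.

Let sE u : U2 u -> s u = K u `^ al / c u.
Proof.
move=> Uu; apply: (mulfI (lt0r_neq0 (c_gt0 Uu))); rewrite mulrCA mulfV ?mulr1 ?gt_eqF ?c_gt0 //.
rewrite (soliton (sub20 Uu)) (dot_support sX EE EN N01 (sub21 Uu)) ?opprK //.
exact: XN (sub20 Uu).
Qed.

Let s_gt0 u : U2 u -> 0 < s u.
Proof.
move=> Uu; rewrite (sE Uu); apply: divr_gt0; last exact: c_gt0.
by apply: powR_gt0; exact: K0 (sub20 Uu).
Qed.

Let detW_gt0 u : U2 u -> 0 < \det (W u).
Proof.
move=> Uu; rewrite (detW Uu); apply: divr_gt0; last exact: K0 (sub20 Uu).
by apply: exprn_gt0; exact: c_gt0.
Qed.

Let pde u : U2 u -> al * ln (\det (W u)) + ln (s u) + ((n%:R + 2) * al - 1) / 2 * ln (1 + Y u) = 0.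
Proof.
move=> Uu; have c0 := c_gt0 Uu; have k0 := K0 (sub20 Uu).
have Y2 : 1 + Y u = c u ^- 2.
  by apply: (mulfI (expf_neq0 2 (lt0r_neq0 c0))); rewrite cY // mulfV // expf_neq0 // gt_eqF.
have kp : 0 < K u `^ al by exact: powR_gt0.
have [cn cc] : 0 < c u ^+ n.+2 /\ 0 < c u ^+ 2 by split; exact: exprn_gt0.
rewrite (detW Uu) (sE Uu) Y2 (ln_div cn k0) (ln_div kp c0) (lnV cc).
rewrite !lnXn // ln_powR -[_ *+ n.+2]mulr_natl -[_ *+ 2]mulr_natl -(addn2 n) natrD; by field.
Qed.

(** [w] is the covector sum z_i dx_i. On such covectors the inverse second form is W / c, and the
    inverse metric is that of 1 + y^T y. *)
Let formW u (z : 'rV[R]_n) : U2 u ->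
  let w := z *m (Jx u)^T in
  (w *m invmx (normal_hessian X (N u) u) *m w^T) 0 0 = (c u)^-1 * (z *m W u *m z^T) 0 0 /\
  (w *m invmx (metric X u) *m w^T) 0 0 = dot z z - dot z (\row_i y i u) ^+ 2 / (1 + Y u).
Proof.
move=> Uu w; have c0 := c_gt0 Uu; have uc : c u != 0 by rewrite gt_eqF.
have uJT : (Jx u)^T \in unitmx by rewrite unitmx_tr uJx.
have invE (B C : 'M[R]_n) : B *m C = 1%:M -> invmx B = C.
  by move=> BC; have [uB _] := mulmx1_unit BC; apply: (can_inj (mulKmx uB)); rewrite mulmxV.
have uB : 1%:M + (\row_i y i u)^T *m \row_i y i u \in unitmx.
  rewrite unitmxE unitfE det_add_rank1 -dotE rowY.
  have : c u ^+ 2 * (1 + Y u) != 0 by rewrite cY // oner_neq0.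
  by rewrite mulf_eq0 negb_or => /andP[].
rewrite -rowY -invmx_add_rank1 (gE (sub21 Uu)) (hE (sub21 Uu)); set B := _ + _ in uB *.
have -> : invmx (c u *: H u) = (c u)^-1 *: (invmx (Jx u)^T *m invmx (Jy u)).
  apply: invE; rewrite -scalemxAr -scalemxAl scalerA mulVf // scale1r /H.
  by rewrite mulmxA mulmxK // mulmxV ?uJy.
have -> : invmx (Jx u *m B *m (Jx u)^T) = invmx (Jx u)^T *m invmx B *m invmx (Jx u).
  by apply: invE; rewrite !mulmxA mulmxK // mulmxK // mulmxV ?uJx.
have wE : w^T = Jx u *m z^T by rewrite trmx_mul trmxK.
rewrite wE /w; split.
  rewrite -scalemxAr -scalemxAl mxE; congr (_ * _); rewrite !mulmxA mulmxK //.
by rewrite !mulmxA mulmxK // -(mulmxA _ (invmx (Jx u))) mulVmx ?uJx // mulmx1.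
Qed.

Let maxW u : U2 u -> forall zeta : 'I_n -> R,
  s u * (\sum_k \sum_m zeta k * zeta m * W u k m) <=
  (K z0 `^ al * (l z0)^-1 - th / 2 * dot (X z0) (X z0)
   + th / 2 * (\sum_i x i u * x i u + (\sum_i x i u * y i u - s u) ^+ 2)) *
  (\sum_k zeta k ^+ 2 - (\sum_k zeta k * y k u) ^+ 2 * (1 - Y u)).
Proof.
move=> Uu zeta; have U0u := sub20 Uu; have c0 := c_gt0 Uu.
pose z : 'rV[R]_n := \row_k zeta k.
have [E1 E2] := formW z Uu.
have lwz := lw U0u (z *m (Jx u)^T); rewrite E1 E2 in lwz.
have zWz : (z *m W u *m z^T) 0 0 = \sum_k \sum_m zeta k * zeta m * W u k m.
  rewrite mxE; under eq_bigr do rewrite !mxE mulr_suml.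
  rewrite exchange_big; apply: eq_bigr => k _; apply: eq_bigr => m _.
  by rewrite mxE mulrAC.
have zz : dot z z = \sum_k zeta k ^+ 2 by apply: eq_bigr => k _; rewrite !mxE.
have zy : dot z (\row_i y i u) = \sum_k zeta k * y k u by apply: eq_bigr => k _; rewrite !mxE.
rewrite zWz zz zy in lwz.
(* This is the squared length of a covector; its sign is needed when [C] replaces K^al / l as its
   coefficient. *)
have Q0 : 0 <= \sum_k zeta k ^+ 2 - (\sum_k zeta k * y k u) ^+ 2 / (1 + Y u).
  rewrite -zz -zy -E2; set w := z *m _.
  have ug := posdef_unitmx (gpos U0u).
  have [->|w0] := eqVneq w 0; first by rewrite !mul0mx mxE.
  have v0 : w *m invmx (metric X u) != 0.
    by apply: contra_neq w0 => v0; rewrite -(mulmxKV ug w) v0 mul0mx.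
  have := gpos U0u v0; rewrite trmx_mul trmx_inv first_form_sym mulmxKV // mulmxA.
  by move/ltW.
rewrite -(norm_graph X EE EN N01).
have wm := wmax U0u.
set C := (_ - _ + _).
have CK : K u `^ al * (l u)^-1 <= C by rewrite /C -lerBlDr.
have lu := l0 U0u; have Ka0 : 0 < K u `^ al by rewrite powR_gt0 // K0.
have Kl0 : 0 <= K u `^ al * (l u)^-1 by apply: mulr_ge0; rewrite ?invr_ge0 ltW.
have C0 : 0 <= C by exact: le_trans CK.
rewrite (sE Uu); move: (\sum_k \sum_m _) lwz => S lwz.
apply: (le_trans (y := K u `^ al * (l u)^-1 * (\sum_k zeta k ^+ 2 - (\sum_k zeta k * y k u) ^+ 2 / (1 + Y u)))).
  have -> : K u `^ al / c u * S = K u `^ al * (l u)^-1 * (l u * ((c u)^-1 * S)).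
    by field; rewrite !gt_eqF.
  by rewrite ler_wpM2l.
apply: (le_trans (y := C * (\sum_k zeta k ^+ 2 - (\sum_k zeta k * y k u) ^+ 2 / (1 + Y u)))).
  by rewrite ler_wpM2r.
(* Here 1 / (1 + Y) >= 1 - Y, with equality at z0; the polynomial bound keeps reciprocals out of the
   test function. *)
rewrite ler_wpM2l // lerD2l lerN2 ler_wpM2l ?sqr_ge0 //.
have Y0 : 0 <= Y u by apply: sumr_ge0 => k _; rewrite -expr2 sqr_ge0.
rewrite -[leRHS]mul1r ler_pdivlMr ?ltr_wpDr // -subr_ge0.
have -> : 1 - (1 - Y u) * (1 + Y u) = Y u ^+ 2 by ring.
exact: sqr_ge0.
Qed.

Let y0 i : y i z0 = 0.
Proof. by apply: big1 => k _; rewrite (partial_heightE sX N0 k U0z0) (XN U0z0) mulr0. Qed.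

Let U1z0 : U1 z0.
Proof.
split=> //=; rewrite exprn_even_gt0 //=.
by have [_] := mulmx1_unit Jx0; rewrite unitmxE unitfE.
Qed.

Let c0E : c z0 = 1. Proof. exact: N01. Qed.

Let U2z0 : U2 z0.
Proof.
split=> //=; have := posdef_diag i0 (hpos U0z0).
by rewrite (hE U1z0) c0E scale1r.
Qed.

Let d_gt0 i : 0 < d 0 i. Proof. exact: (diagonalized_posdef Pg Ph i (hpos U0z0)). Qed.

(** Thus b_i = 1 / d_i, and the smallest principal curvature corresponds to the largest eigenvalue
    of W. *)
Let W0 i j : W z0 i j = (i == j)%:R * (d 0 i)^-1.
Proof.
have Jy0 : P *m Jy z0 = diag_mx d.
  rewrite -Ph (hE U1z0) c0E scale1r /H -!mulmxA -trmx_mul Jx0 trmx1 mulmx1 //.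
have JW : Jy z0 *m W z0 = Jx z0 by rewrite /W mulKVmx // uJy.
have : (diag_mx d *m W z0) i j = (i == j)%:R by rewrite -Jy0 -mulmxA JW Jx0 mxE.
rewrite mul_diag_mx mxE => <-.
by rewrite mulrC mulKf // gt_eqF.
Qed.

Lemma local_umbilic :
  (forall k, dot (partial k X z0) (X z0) = 0) /\ forall i, d 0 i = d 0 i0.
Proof.
have sub2 : U2 `<=` U1 by move=> u; exact: sub21.
have sW i j : smooth_fun U2 (fun u => W u i j).
  have sinv k : smooth_fun U2 (fun u => invmx (Jy u) i k).
    by apply: (smooth_fun_invmx uJy) => a a'; exact: smooth_funW sub2 (sJy a a').
  apply: (smooth_fun_ext (f := fun u => \sum_k invmx (Jy u) i k * Jx u k j)).
    apply: smooth_fun_sum => k; apply: smooth_funM => //; exact: smooth_funW sub2 (sJx k j).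
  by move=> u _; rewrite [RHS]mxE.
have [|||x0 bE] := @monge_ampere_umbilic R n U2 y x s W z0 al th
   (K z0 `^ al * (l z0)^-1 - th / 2 * dot (X z0) (X z0)) (fun i => (d 0 i)^-1) i0
   oU2 U2z0 n2 al0 th0 Eth (fun i => smooth_funW sub2 (sy i)) uJy (fun i => smooth_funW sub2 (sx i))
   (smooth_funW sub2 (support_smooth oU0 sX E N0)) sW
   (fun i u Uu => frame_support oU0 sX i (sub21 Uu) (uJy Uu))
   (fun i j u _ => frame_tangential X E N0 i j u)
   s_gt0 detW_gt0 pde maxW y0 W0.
- by move=> i; rewrite invr_gt0.
- by move=> i; rewrite lef_pV2 ?posrE.
- have -> : \sum_i x i z0 * x i z0 + s z0 ^+ 2 = dot (X z0) (X z0).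
    have xy0 : \sum_i x i z0 * y i z0 = 0 by apply: big1 => i _; rewrite y0 mulr0.
    by rewrite (norm_graph X EE EN N01) xy0 sub0r sqrrN.
  by rewrite subrK (sE U2z0) c0E divr1 di0.
split=> [k|i]; last by apply: invr_inj; exact: bE.
rewrite (parseval EE EN N01) [dot (partial k X z0) N0](XN U0z0) mul0r addr0 big1 // => i _.
by rewrite [dot (X z0) (E i)]x0 mulr0.
Qed.

End LocalTheorem.

(** * From the manifold to the chart around p0 *)

Theorem theorem3p2 (R : realType) (n : nat) (hn : (2 <= n)%N)
    (alpha : R) (halpha : n%:R^-1 < alpha < 1 + n%:R^-1)
    (M : topologicalType) (hM : closed_manifold M)
    (A : smooth_structure R n M)
    (Sigma : set 'rV[R]_n.+1) (hSigma : closed_hypersurface Sigma)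
    (F : M -> 'rV[R]_n.+1) (hF : smooth_immersion A F)
    (hFSigma : range F = Sigma)
    (nu : M -> 'rV[R]_n.+1) (hnu : is_interior_unit_normal A F nu Sigma)
    (hconv : strictly_convex A F nu)
    (hK : forall p, gauss_curvature A F nu p `^ alpha = - dot (F p) (nu p))
    (p0 : M) (hmax : forall p, w_fun A F nu alpha p <= w_fun A F nu alpha p0) :
  umbilical A F nu p0 /\ gradient A F (norm2 F) p0 = 0.
Proof.
have n0 : (0 < n)%N by exact: leq_trans hn.
have nR0 : 0 < n%:R :> R by rewrite ltr0n.
have [al0 nal1] : 0 < alpha /\ 1 < n%:R * alpha.
  have /andP[h _] := halpha; split; first by apply: lt_trans h; rewrite invr_gt0.
  by rewrite -ltr_pdivrMl // mulr1.
pose th := (n%:R * alpha - 1) / (n%:R * alpha).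
have na0 : 0 < n%:R * alpha by exact: lt_trans nal1.
have th0 : 0 < th by rewrite divr_gt0 // subr_gt0.
have Eth : n%:R * alpha * th = n%:R * alpha - 1 by rewrite /th mulrC divfK // gt_eqF.
have nuT p i : dot (partial i (in_chart A F p) (Defs.coord A p)) (nu p) = 0 by have [_ /(_ i)] := hnu p.
have nu1 p : dot (nu p) (nu p) = 1 by have [] := hnu p.
pose U0 := chart_cod (chart_at A p0); pose X := in_chart A F p0; pose z0 := Defs.coord A p0.
pose inv0 := chart_inv (chart_at A p0).
have oU0 : open U0 by exact: chart_cod_open.
have sX : smooth_on U0 X := (hF p0).1.
have Uz0 : U0 z0 := coord_cod A p0.
have invz0 : inv0 z0 = p0 by exact: coordK.
have FX u : F (inv0 u) = X u by [].
pose g0 := metric X z0; pose h0 := normal_hessian X (nu p0) z0.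
have curv u : U0 u -> _ := @curvature_at R n M A F nu hF nuT hconv p0 u n0.
pose N u := nu (inv0 u).
have [XN0 [gpos hpos] _ _ _] := curv z0 Uz0.
rewrite -/inv0 in XN0 hpos.
have gs : g0^T = g0 := first_form_sym X z0.
have hs : (normal_hessian X (N z0) z0)^T = normal_hessian X (N z0) z0.
  exact: (normal_hessian_sym oU0 sX (N z0) Uz0).
have [P [d [Pg Ph]]] := simultaneous_diagonalization gs hs gpos.
have spec : perm_eq (principal_curvatures A F nu p0) [seq d 0 i | i <- enum 'I_n].
  have E : principal_curvatures A F nu p0 =
      sorted_spectrum (normal_hessian X (N z0) z0 *m invmx (metric X z0)).
    rewrite /principal_curvatures /shape_operator -/X -/z0 second_form_normal /N ?invz0 //.
    by move=> k; exact: nuT.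
  by rewrite E; exact: diagonalized_spectrum Pg Ph gs hs gpos.
have hp0 : posdef (second_form_at A F nu p0) by exact: hconv.
have gp0 : (metric_at A F p0)^T = metric_at A F p0 by exact: first_form_sym.
have hp0s : (second_form_at A F nu p0)^T = second_form_at A F nu p0.
  by rewrite /second_form_at -/X -/z0 second_form_normal; [rewrite -{1 2}invz0 | move=> k; exact: nuT].
have [_ _ _ hmin _] := spectrum_min n0 gp0 hp0s gpos hp0.
have dmem i : d 0 i \in principal_curvatures A F nu p0.
  by rewrite (perm_mem spec); apply: map_f; rewrite mem_enum.
have lmem : lambda_min A F nu p0 \in principal_curvatures A F nu p0.
  rewrite /lambda_min; case: (principal_curvatures A F nu p0) (dmem (Ordinal n0)) => [//|a t _].
  exact: mem_head.
(* This index plays the role of the direction e_1. *)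
have [i0 di0] : exists i0, d 0 i0 = lambda_min A F nu p0.
  by move: lmem; rewrite (perm_mem spec) => /mapP[i _ ->]; exists i.
have dmin i : d 0 i0 <= d 0 i by rewrite di0; apply: hmin; exact: dmem.
have thE : (n%:R * alpha - 1) / (2 * n%:R * alpha) = th / 2.
  by rewrite /th; field; rewrite !gt_eqF.
have [||||||||||| tangent dE] := @local_umbilic R n U0 X N (fun u => gauss_curvature A F nu (inv0 u))
  (fun u => lambda_min A F nu (inv0 u)) alpha th z0 oU0 sX Uz0 hn al0 th0 Eth
  _ _ _ _ _ _ _ _ _ _ P d i0 Pg Ph _ dmin.
- by move=> u /curv [].
- by move=> u _; exact: nu1.
- by move=> u /curv [_ []].
- by move=> u /curv [_ []].
- by move=> u /curv [_ _ []].
- by move=> u /curv [_ _ []].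
- by move=> u /curv [].
- by move=> u /curv [].
- by move=> u _; exact: hK.
- by move=> u _; rewrite invz0; have := hmax (inv0 u); rewrite /w_fun thE /norm2 -(in_chart_coord A F p0).
- by rewrite invz0.
split.
  move=> k m; rewrite !(perm_mem spec) => /mapP[i _ ->] /mapP[j _ ->].
  by rewrite (dE i) (dE j).
apply/rowP => i; rewrite !mxE big1 // => j _.
(* The derivative of |F|^2 is 2 <d_j F, F>, and it vanishes because F(p0) is orthogonal to the
   tangent space. *)
suff -> : partial j (in_chart A (norm2 F) p0 : 'rV[R]_n -> R^o) z0 = 0 by rewrite mulr0.
have dX : differentiable X z0 by exact: (sX [::]).
by rewrite (partial_norm2 j dX) tangent mulr0.
Qed.
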